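(* Let $G$ be a finite insoluble group. If $G$ is a biminimal non-nilpotent group, then $G$ is isomorphic to $\mathrm{SL}(2,5)$ or $A_5$.
   Context: A group is minimal non-nilpotent if it is not nilpotent but all its proper subgroups are nilpotent. A group is biminimal non-nilpotent if it is neither nilpotent nor minimal non-nilpotent, but each of its proper subgroups is either nilpotent or minimal non-nilpotent. *)

(* Defs.v *)
From HB Require Import structures.
From mathcomp Require Import all_boot all_order all_fingroup all_algebra.
From mathcomp Require Import all_solvable.

Set Implicit Arguments.
Unset Strict Implicit.
Unset Printing Implicit Defensive.

Import GroupScope GRing.Theory.

Section MinimalNonNilpotent.

Variable gT : finGroupType.
Implicit Types G H : {group gT}.

Definition minimal_nonnilpotent G : Prop :=
  ~ nilpotent G /\ (forall H, H \proper G -> nilpotent H).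

Definition biminimal_nonnilpotent G : Prop :=
  [/\ ~ nilpotent G,
      ~ minimal_nonnilpotent G
    & forall H, H \proper G -> nilpotent H \/ minimal_nonnilpotent H].

End MinimalNonNilpotent.

(* As for 'GL_n[R], the matrices have size n.-1.+1, so n = 0 is read as 1. *)
Definition SLgroup (n : nat) (R : finComUnitRingType) : {set {'GL_n[R]}} :=
  [set u : {'GL_n[R]} | (\det (GLval u) == 1)%R].

Fact SLgroup_group_set (n : nat) (R : finComUnitRingType) :
  group_set (SLgroup n R).
Proof.
apply/group_setP; split=> [|u v]; first by rewrite inE GL_1E det1.
by rewrite !inE GL_ME det_mulmx => /eqP-> /eqP->; rewrite mulr1.
Qed.

Canonical SLgroup_group (n : nat) (R : finComUnitRingType) :=
  Group (SLgroup_group_set n R).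

(* Main.v *)
(* Let G be insoluble with all subgroups of its proper subgroups nilpotent.
   Suppose first that G is simple. By transfer and the structure of minimal
   non-nilpotent groups, each Sylow subgroup P of G is abelian and is the
   centraliser of each of its nontrivial elements, and N_G(P) is a Frobenius
   group with kernel P and complement of prime order; so the conjugates of
   the Sylow subgroups partition G.
   If |G| is even, counting the pairs of noncommuting involutions by their
   product gives |G| = 60.
   If |G| is odd, call an irreducible character p-exceptional when its
   restriction to a Sylow p-subgroup A_p contains the nontrivial linear
   characters of A_p with unequal multiplicities. A character is exceptional
   for at most one p, and is otherwise a rational integer, constant on A_p - 1.
   For |A_p| minimal, the norm of a p-exceptional character, the orthogonality
   relation for the column of an element of A_p, and the class equation are
   incompatible.
   In general let R be a maximal normal subgroup. Then G / R has order 60, and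
   R is central because QR is nilpotent for each Sylow subgroup Q. As G is
   perfect, transfer puts the Sylow p-subgroup of R inside P^`(1) for
   P a Sylow p-subgroup of G, whence |R| <= 2. If R = 1 then G is A_5. If
   |R| = 2, then inside the fibre product of G and SL(2,5) over A_5 a minimal
   subgroup projecting onto both factors is perfect and central over a group
   of order 60; its order is thus at most 120, so both projections are
   isomorphisms. *)
Require Import Defs.
From mathcomp Require Import all_boot all_order all_fingroup all_algebra.
From mathcomp Require Import all_solvable all_field all_character.
From mathcomp Require Import zify ring.

Set Implicit Arguments.
Unset Strict Implicit.
Unset Printing Implicit Defensive.

(** Nothing restricts the order in advance, so the simple case must exclude odd order directly.
    Sylow subgroups that are centralisers of their elements put this in Suzuki's setting of groups
    with abelian centralisers, but no coherent family of exceptional characters is built. Only the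
    multiplicities of the linear characters of [A_p] are used: inducing a difference of two
    nontrivial ones preserves norms, which fixes the total of the squared differences of
    multiplicities over all characters of [G], while the multiplicities of a single exceptional
    character have large level sets, which bounds its share from below. Minimality of [|A_p|] makes
    [|G : A_p|] the largest such index, so that bounds at other primes can be compared with those at
    [p]. In even order, 60 arises as 3 times 4 times 5, from the only prime [q] such that [q + 1] is
    a power of 2 and [q + 2] is prime. *)

(* [P'], [Q'] and [p.-1 * q.-1] count the nontrivial elements of trivial
   intersection subsets with [NP], [NQ] and [NL] conjugates. *)
Lemma mixed_count_absurd p q a b P' Q' NP NQ NL :
    1 < p -> 1 < q -> 1 < a -> 1 < b -> 0 < NL ->
    p * a = P'.+1 -> q * b = Q'.+1 ->
    p * a * q * NP = p * q * NL -> q * b * p * NQ = p * q * NL ->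
  P' * NP + Q' * NQ + p.-1 * q.-1 * NL < p * q * NL -> False.
Proof.
case: p q => [|p] [|q] // p_gt1 q_gt1 a_gt1 b_gt1 NL_gt0 eP' eQ' eP eQ.
have {}eP : a * NP = NL.
  by apply/eqP; rewrite -(@eqn_pmul2l (p.+1 * q.+1)) //; apply/eqP; rewrite -eP; ring.
have {}eQ : b * NQ = NL.
  by apply/eqP; rewrite -(@eqn_pmul2l (p.+1 * q.+1)) //; apply/eqP; rewrite -eQ; ring.
have eP2 : P' * NP + NP = p.+1 * NL by rewrite -eP mulnA eP'; ring.
have eQ2 : Q' * NQ + NQ = q.+1 * NL by rewrite -eQ mulnA eQ'; ring.
(* As [a] and [b] are at least 2, the first two terms fall short of [p.+1 * NL] and [q.+1 * NL] by
   at most [NL / 2] each. The third equals [p.+1 * q.+1 * NL - p.+1 * NL - q.+1 * NL + NL], so the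
   total is not below the order. *)
have leP : 2 * NP <= NL by rewrite -eP leq_mul2r a_gt1 orbT.
have leQ : 2 * NQ <= NL by rewrite -eQ leq_mul2r b_gt1 orbT.
have -> : p.+1 * q.+1 * NL = p * q * NL + p * NL + q * NL + NL by ring.
rewrite !mulSn in eP2 eQ2; rewrite /=; lia.
Qed.

Lemma prod_primes_dvdn (s : seq nat) K :
  uniq s -> {in s, forall p, prime p && (p %| K)} -> \prod_(p <- s) p %| K.
Proof.
elim: s => [|p s IHs] /=; first by rewrite big_nil dvd1n.
case/andP=> ps us sP; rewrite big_cons; have /andP[p_pr pK] := sP p (mem_head p s).
rewrite Gauss_dvd ?pK ?IHs // => [r rs|]; first by rewrite sP // inE rs orbT.
rewrite big_seq; elim/big_ind: _ => [|a b|r rs]; rewrite ?coprimen1 // ?coprimeMr.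
  by move=> -> ->.
have /andP[r_pr _] : prime r && (r %| K) by rewrite sP // inE rs orbT.
by rewrite prime_coprime // dvdn_prime2 //; apply: contraNneq ps => ->.
Qed.

Lemma sum_pred_le_prod (s : seq nat) :
  {in s, forall p, 1 < p} -> \sum_(p <- s) p.-1 < \prod_(p <- s) p.
Proof.
elim: s => [|p s IHs] sP; first by rewrite !big_nil.
have p_gt1 := sP p (mem_head p s).
have /IHs : {in s, forall r, 1 < r} by move=> r rs; apply: sP; rewrite inE rs orbT.
rewrite !big_cons; case: p p_gt1 {sP} => // p p_gt0; rewrite ltnS in p_gt0.
case: (\prod_(r <- s) r) => // P lt_s /=; nia.
Qed.

(** With a second factor, the cross term [(p - 1) * Y], for [Y] the sum over the tail, is positive
    and makes the product too large. *)
Lemma sum_pred_eq_prod (s : seq nat) :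
  {in s, forall p, 1 < p} -> \prod_(p <- s) p = (\sum_(p <- s) p.-1).+1 -> size s <= 1.
Proof.
case: s => [|p [|r s]] // sP; have p_gt1 := sP p (mem_head p _).
have r_gt1 : 1 < r by apply: sP; rewrite !inE eqxx orbT.
have lt_rs : \sum_(t <- r :: s) t.-1 < \prod_(t <- r :: s) t.
  by apply: sum_pred_le_prod => t ts; apply: sP; rewrite inE ts orbT.
have gt1 : 0 < \sum_(t <- r :: s) t.-1.
  by rewrite big_cons; case: r r_gt1 {sP lt_rs} => [|[|r]].
rewrite big_cons [\sum_(_ <- p :: _) _]big_cons; move: gt1 lt_rs.
set Y := \sum_(t <- _) _; set X := \prod_(t <- _) _.
case: p p_gt1 {sP} => // p p_gt0 Y_gt0 ltYX /= eX; exfalso.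
have : p * Y.+1 <= p * X by rewrite leq_mul2l ltYX orbT.
rewrite mulSn in eX; rewrite mulnS; have : 0 < p * Y by rewrite muln_gt0 Y_gt0 andbT.
lia.
Qed.

(* The equation counts the pairs of involutions of a group of order [m * q * K]
   with [K] Sylow 2-subgroups of order [m]; [s] lists the orders of the Sylow
   subgroups inverted by an involution. *)
Lemma involution_count_arith m q K n (s : seq nat) :
    m = 2 ^ n -> 0 < n -> prime q -> odd q -> q %| m.-1 -> 1 < K ->
    uniq s -> {in s, forall p, [&& prime p, odd p & p %| q * K]} ->
    2 * m.-1 ^ 2 * K.-1 = m * q * \sum_(p <- s) p.-1 ->
  m * q * K = 60.
Proof.
move=> em n_gt0 q_pr q_odd /dvdnP[t et] K_gt1 us sP eqK.
have q_gt2 : 2 < q by rewrite odd_prime_gt2.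
have m_gt1 : 1 < m.
  by case: n n_gt0 em => [|n] // _ ->; rewrite -{1}(exp1n n.+1) ltn_exp2r.
have {}et : m = (t * q).+1 by rewrite -et prednK // ltnW.
have t_gt0 : 0 < t by case: t et => // et; rewrite et in m_gt1.
have q_gt0 : 0 < q by apply: ltn_trans q_gt2.
have [S eS] : exists S, \sum_(p <- s) p.-1 = 2 * S.
  exists (\sum_(p <- s) p./2); rewrite big_distrr /= [LHS]big_seq [RHS]big_seq.
  apply: eq_bigr => p /sP/and3P[_ p_odd _].
  by rewrite mul2n -[p in LHS]odd_double_half p_odd.
have {}eqK : t ^ 2 * q * K.-1 = m * S.
  apply/eqP; rewrite -(@eqn_pmul2l (2 * q)) ?muln_gt0 //; apply/eqP.
  move: eqK; rewrite eS [m in m.-1]et /= => eqK.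
  by transitivity (2 * (t * q) ^ 2 * K.-1); [ring | rewrite eqK; ring].
have co_m : coprime m (t ^ 2 * q).
  rewrite coprimeMr coprimeXr ?et; first last.
    by rewrite mulnC -addn1 /coprime gcdnC gcdnMDl gcdn1.
  by rewrite -addn1 /coprime gcdnC gcdnMDl gcdn1.
have /dvdnP[l eK] : m %| K.-1.
  by rewrite -(Gauss_dvdr _ co_m) eqK dvdn_mulr.
have {}eS : \sum_(p <- s) p.-1 = 2 * (t ^ 2 * q * l).
  rewrite eS; congr (2 * _); apply/eqP; rewrite -(@eqn_pmul2l m) -?eqK ?eK; last exact: ltnW.
  by apply/eqP; ring.
have l_gt0 : 0 < l.
  by rewrite lt0n; apply: contraTneq K_gt1 => l0; rewrite -leqNgt -subn_eq0 subn1 eK l0.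
(* The primes of [s] other than [q] divide [K = l * m + 1], hence so does their product, which
   bounds the sum of their predecessors by [l * m]. The prime [q] need not divide [K] and is treated
   apart. *)
pose s' := [seq p <- s | p != q].
have s'P : {in s', forall p, prime p && (p %| K)}.
  move=> p; rewrite mem_filter => /andP[npq /sP/and3P[p_pr _]]; rewrite p_pr /=.
  by rewrite Gauss_dvdr // prime_coprime // dvdn_prime2.
have s'_gt1 : {in s', forall p, 1 < p} by move=> p /s'P/andP[/prime_gt1].
have leP : \prod_(p <- s') p <= (l * m).+1.
  rewrite -eK prednK ?(ltnW K_gt1) // dvdn_leq ?(ltnW K_gt1) //.
  exact: prod_primes_dvdn (filter_uniq _ us) s'P.
have ltS := leq_trans (sum_pred_le_prod s'_gt1) leP.
have eS' : \sum_(p <- s) p.-1 = (if q \in s then q.-1 else 0) + \sum_(p <- s') p.-1.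
  rewrite big_filter; case: ifP => [qs | nqs]; first by rewrite (bigD1_seq q).
  rewrite add0n [RHS]big_mkcond /= [LHS]big_seq [RHS]big_seq; apply: eq_bigr => p ps.
  by rewrite ifT //; apply: contraTneq ps => ->; rewrite nqs.
rewrite {}eS in eS'; rewrite ltnS in ltS.
have tq_gt0 : 0 < t * q by rewrite muln_gt0 t_gt0.
(* The whole sum is [2 * t ^ 2 * q * l], and the primes other than [q] give at most
   [l * (t * q + 1)]. That is too little without [q]; with [q] it suffices only for [t = l = 1], and
   then with equality. *)
case: ifP eS' => qs eS'; last first.
  exfalso; rewrite add0n in eS'; move: ltS; rewrite -eS' et.
  have -> : 2 * (t ^ 2 * q * l) = l * (2 * (t * (t * q))) by ring.
  rewrite leq_pmul2l //.
  have : t * q <= t * (t * q) by rewrite leq_pmull.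
  have : q <= t * q by rewrite leq_pmull.
  lia.
have ql_ge : q + l <= (q * l).+1.
  have ge_mul c d : 0 < c -> 0 < d -> c + d <= (c * d).+1.
    by case: c d => [|c] [|d] // _ _; clear; lia.
  exact: ge_mul.
have t1 : t = 1.
  apply/eqP; rewrite eqn_leq t_gt0 andbT leqNgt; apply/negP=> t_gt1.
  have le2 : 4 * (t * (q * l)) <= 2 * (t ^ 2 * q * l).
    have -> : 2 * (t ^ 2 * q * l) = (2 * t) * (t * (q * l)) by ring.
    by rewrite leq_mul2r (_ : 4 = 2 * 2) // leq_pmul2l // t_gt1 orbT.
  have le3 : q * l <= t * (q * l) by rewrite leq_pmull.
  have e4 : l * m = t * (q * l) + l by rewrite et; ring.
  have : 0 < q * l by rewrite muln_gt0 q_gt0.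
  move: le2 le3 e4 eS' ltS ql_ge; clear -q_gt0.
  move: (2 * (t ^ 2 * q * l)) (t * (q * l)) (q * l) (l * m) (\sum_(p <- s') p.-1).
  lia.
have e4 : l * m = q * l + l by rewrite et t1; ring.
have l1 : l = 1.
  have le5 : q * l <= q.-1 + l.
    have : 2 * (t ^ 2 * q * l) = 2 * (q * l) by rewrite t1; ring.
    move: e4 eS' ltS ql_ge; clear -q_gt0.
    move: (2 * (t ^ 2 * q * l)) (q * l) (l * m) (\sum_(p <- s') p.-1).
    lia.
  case: l l_gt0 le5 {eK ltS leP eS' ql_ge e4} => [|[|l]] // _; rewrite mulnS; nia.
have em1 : m = q.+1 by rewrite et t1 mul1n.
have eS1 : \sum_(p <- s') p.-1 = q.+1.
  by move: eS'; rewrite t1 l1 exp1n mul1n muln1; lia.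
have eK1 : K = q.+2 by rewrite -(prednK (ltnW K_gt1)) eK l1 em1 mul1n.
have : size s' <= 1.
  apply: (sum_pred_eq_prod s'_gt1); apply/eqP; rewrite eqn_leq sum_pred_le_prod // andbT.
  by rewrite (leq_trans leP) // eS1 l1 em1 mul1n.
case def_s': s' => [|p [|]] //= _; first by rewrite def_s' big_nil in eS1.
have /andP[p_pr _] : prime p && (p %| K) by rewrite s'P // def_s' mem_head.
have ep : p = q.+2.
  by move: eS1; rewrite def_s' big_seq1 => <-; rewrite prednK ?prime_gt0.
(* One of [q], [m = q + 1] and [p = q + 2] is a multiple of 3. It is not [m], a power of 2, and
   [p = 3] would give [q = 1]. *)
have : q %% 3 < 3 by rewrite ltn_mod.
case e3: (q %% 3) => [|[|[|]]] // _.
- have /eqP q3 : 3 == q by rewrite -(dvdn_prime2 (isT : prime 3) q_pr) /dvdn e3.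
  by rewrite eK1 em1 -q3.
- have /eqP p3 : 3 == p.
    by rewrite -(dvdn_prime2 (isT : prime 3) p_pr) ep /dvdn -addn2 -modnDml e3.
  by rewrite -p3 in ep; rewrite -ltnS -ltnS -ep in q_gt2.
have : 3 %| 2 ^ n by rewrite -em em1 /dvdn -addn1 -modnDml e3.
by rewrite Euclid_dvdX.
Qed.

Import GroupScope.

(** * Local structure of simple groups with nilpotent second maximal subgroups *)

(** The transfer from [G] to the abelianisation of [P] is trivial because [G] is perfect. Expanded
    along the cycles of [g] on the cosets of [P], it is a product of conjugates of powers of [g],
    and [fus] replaces each conjugate by the power itself. The product becomes [g ^+ #|G : P|],
    whose exponent is prime to the order of [g]. *)
Lemma transfer_perfect (gT : finGroupType) (G P : {group gT}) p g :
  p.-Sylow(G) P -> G^`(1) = G -> g \in P ->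
  (forall n x, x \in G -> (g ^+ n) ^ x \in P -> [~ g ^+ n, x] \in P^`(1)) ->
  g \in P^`(1).
Proof.
move=> sylP perfG Pg fus; have sPG := pHall_sub sylP; have Gg := subsetP sPG g Pg.
pose alpha := restrm_morphism (der_norm 1 P) (coset_morphism P^`(1)).
have im_alpha : alpha @* P = P / P^`(1) by rewrite morphim_restrm setIid.
have abA : abelian (alpha @* P) by rewrite im_alpha sub_der1_abelian.
have tr0 : transfer G abA g = 0%R.
  suff: G \subset 'ker (transfer G abA) by move/subsetP/(_ g Gg)/mker.
  rewrite -{1}perfG; apply: der1_min; first exact: ker_norm.
  rewrite (isog_abelian (first_isog _)).
  by apply/centsP=> x _ y _; apply: FinRing.zmod_mulgC.
have trX := transversalP (rcosets_cycle_partition sPG Gg).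
set X := transversal _ _ in trX; have sXG := subsetP (transversal_sub trX).
have cgA : coset P^`(1) g \in alpha @* P by rewrite im_alpha mem_quotient.
have nP'g : g \in 'N(P^`(1)) by apply: (subsetP (der_norm 1 P)).
have expn : FiniteModule.fmod abA (coset P^`(1) g ^+ #|G : P|) = 0%R.
  rewrite FiniteModule.fmodX // -(sum_index_rcosets_cycle sPG Gg trX).
  rewrite -tr0 (transfer_cycle_expansion sPG abA Gg trX) -GRing.sumrMnr.
  apply: eq_bigr => x Xx; set n := #|_ : _|.
  have Gx := sXG x Xx.
  have Pgx : (g ^+ n) ^ x^-1 \in P.
    by have := mulg_exp_card_rcosets P g x; rewrite mem_rcoset conjgE invgK mulgA.
  rewrite /= /restrm /= -FiniteModule.fmodX //; congr (FiniteModule.fmod _ _).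
  have fgx : [~ g ^+ n, x^-1] \in P^`(1) by rewrite fus ?groupV.
  rewrite /= -morphX //= (conjg_mulR (g ^+ n)) morphM ?groupX //=; last first.
    by rewrite (subsetP (normG _)).
  by rewrite (coset_id fgx) mulg1.
have /eqP := congr1 FiniteModule.fmval expn.
have -> : FiniteModule.fmval (0%R : FiniteModule.fmod_of abA) = 1 by [].
have -> : FiniteModule.fmval (FiniteModule.fmod abA (coset P^`(1) g ^+ #|G : P|))
    = coset P^`(1) g ^+ #|G : P| by apply: FiniteModule.fmodK; rewrite groupX.
rewrite -morphX //= => /eqP/coset_idr; rewrite groupX // => /(_ isT) P'gn.
have co_n : coprime #[g] #|G : P|.
  apply: (@pnat_coprime p); first exact: mem_p_elt (pHall_pgroup sylP) Pg.
  by case/and3P: sylP.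
move: co_n; rewrite -generator_coprime => /eqP def_g.
by rewrite -cycle_subG def_g cycle_subG.
Qed.

Lemma pnat_neq_coprime (p q m n : nat) :
  p.-nat m -> q.-nat n -> p != q -> coprime m n.
Proof.
move=> pm qn neq; apply: (pnat_coprime pm); apply: sub_in_pnat qn => r _ /eqP->.
by rewrite !inE eq_sym.
Qed.

(** Take [D = P :&: P :^ g] of maximal order with [g] outside ['N(P)]. A Sylow subgroup of ['N_G(D)]
    over ['N_P(D)] lies in some [P :^ h] meeting [P] in more than [D], so [h] normalises [P]. Were
    ['N_P(D)] normal in ['N_G(D)], it would contain the normaliser of [D] in [P :^ g], which would
    then lie in [D], although normalisers grow in [p]-groups. *)
Lemma Sylow_TI_or_local (gT : finGroupType) (G P : {group gT}) p :
    p.-Sylow(G) P ->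
  {in G, forall g, P :&: P :^ g != 1 -> g \in 'N(P)} \/
  exists D : {group gT}, [/\ D :!=: 1, D \proper P,
    p.-Sylow('N_G(D)) 'N_P(D) & ~~ ('N_P(D) <| 'N_G(D))].
Proof.
move=> sylP; have [sPG pP _] := and3P sylP.
have [/forall_inP TI|] := boolP [forall g in G, (P :&: P :^ g != 1) ==> (g \in 'N(P))].
  by left=> g Gg; apply: implyP (TI g Gg).
rewrite negb_forall_in => /exists_inP[g0 Gg0]; rewrite negb_imply => /andP[nt0 nP0].
have C0 : (g0 \in G) && (g0 \notin 'N(P)) by rewrite Gg0.
right; case: (@arg_maxnP _ g0 (fun g => (g \in G) && (g \notin 'N(P)))
  (fun g => #|P :&: P :^ g|) C0) => g /andP[Gg nPg] maxg.
exists (P :&: P :^ g)%G; set D := (P :&: P :^ g)%G.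
have ntD : D :!=: 1.
  apply: contraNneq nt0 => D1; rewrite trivg_card_le1.
  by rewrite (leq_trans (maxg g0 C0)) // D1 cards1.
have nil_conj h : nilpotent (P :^ h) by rewrite (pgroup_nil (p := p)) ?pgroupJ.
have prD : D \proper P.
  rewrite properE subsetIl; apply: contra nPg; rewrite subsetI => /andP[_ sPP].
  by rewrite -groupV inE sub_conjgV.
have prDg : D \proper (P :^ g)%G.
  by rewrite properEcard subsetIr cardJg proper_card.
have prDN : D \proper 'N_P(D) by rewrite nilpotent_proper_norm ?(pgroup_nil pP).
have sNN : 'N_P(D) \subset 'N_G(D) by apply: setSI.
have [T sylT sNT] := Sylow_superset sNN (pgroupS (subsetIl _ _) pP).
have [sTN pT _] := and3P sylT.
have [h Gh sTPh] := Sylow_subJ sylP (subset_trans sTN (subsetIl _ _)) pT.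
have nPh : h \in 'N(P).
  apply: contraT => nPh; have := maxg h; rewrite Gh nPh => /(_ isT) /=.
  rewrite leqNgt (leq_trans (proper_card prDN)) // subset_leq_card //.
  by rewrite subsetI subsetIl (subset_trans sNT).
rewrite (normP nPh) in sTPh.
have defT : 'N_P(D) = T.
  by apply/eqP; rewrite eqEsubset sNT subsetI sTPh (subset_trans sTN) ?subsetIr.
split=> //; first by rewrite defT.
rewrite defT; apply/negP => nsT.
have := nilpotent_proper_norm (nil_conj g) prDg; apply/negP.
rewrite properE negb_and negbK orbC; apply/orP; left.
rewrite subsetI subsetIl andbT; apply: subset_trans sTPh.
rewrite (sub_normal_Hall sylT nsT); last first.
  by apply: setSI; rewrite sub_conjg (conjGid (groupVr Gg)).
by rewrite (pgroupS (subsetIl _ _)) ?pgroupJ.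
Qed.

(** In a nilpotent ['N_G(P)] the [p']-part of each element centralises [P], so fusion in [P] is
    realised inside [P]. Then [transfer_perfect] puts [P] inside its own derived subgroup. *)
Lemma Sylow_perfect_norm_nonnil (gT : finGroupType) (G P : {group gT}) p :
    p.-Sylow(G) P -> G^`(1) = G -> P :!=: 1 ->
    {in P & G, forall x z, x ^ z \in P -> exists2 n, n \in 'N_G(P) & x ^ z = x ^ n} ->
  ~~ nilpotent 'N_G(P).
Proof.
move=> sylP perfG ntP fus; apply: contra ntP => nilN.
have [sPG pP _] := and3P sylP.
have nsPN : P <| 'N_G(P) by rewrite normalSG.
have sylPN : p.-Sylow('N_G(P)) P by rewrite (pHall_subl _ _ sylP) ?subsetIl ?normal_sub.
suff sPP' : P \subset P^`(1).
  apply: contraLR sPP' => nt; have := sol_der1_proper (pgroup_sol pP) (subxx P) nt.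
  by rewrite properE => /andP[].
apply/subsetP=> g Pg; apply: (transfer_perfect sylP) => // k x Gx.
set a := g ^+ k; have Pa : a \in P by apply: groupX.
case/(fus a x Pa Gx) => n Nn ax; rewrite commgEl ax.
have Nnp : n.`_p \in P.
  by rewrite (mem_normal_Hall sylPN nsPN) ?p_elt_constt // groupX.
have cPn : n.`_p^' \in 'C(P).
  rewrite -cycle_subG (sub_nilpotent_cent2 nilN) ?cycle_subG ?groupX //.
    exact: normal_sub.
  by apply: (pnat_coprime pP); apply: p_elt_constt.
rewrite -[n in a ^ n](consttC p n) conjgM (conjg_fixP _) -?commgEl ?mem_commg //.
by apply/commgP/commute_sym/(centP cPn); rewrite groupJ.
Qed.

Lemma simple_local_proper (gT : finGroupType) (G D : {group gT}) :
  simple G -> ~~ solvable G -> D \subset G -> D :!=: 1 -> solvable D ->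
  'N_G(D) \proper G.
Proof.
case/simpleP=> _ simG nsolG sDG ntD solD; rewrite properE subsetIl /=.
apply: contra nsolG; rewrite subsetI subxx /= => nDG.
have nsDG : D <| G by apply/andP.
by have [D1|<- //] := simG D nsDG; rewrite D1 eqxx in ntD.
Qed.

Lemma simple_nonsol_perfect (gT : finGroupType) (G : {group gT}) :
  simple G -> ~~ solvable G -> G^`(1) = G.
Proof.
case/simpleP=> _ simG nsolG; have [G'1|//] := simG _ (der_normal 1 G).
by case/negP: nsolG; apply/abelian_sol/derG1P.
Qed.

Lemma Sylow_TI_fusion (gT : finGroupType) (G P : {group gT}) :
    {in G, forall g, P :&: P :^ g != 1 -> g \in 'N(P)} ->
  {in P & G, forall x z, x ^ z \in P -> exists2 n, n \in 'N_G(P) & x ^ z = x ^ n}.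
Proof.
move=> TI x z Px Gz Pxz; have [-> | ntx] := eqVneq x 1.
  by exists 1; rewrite ?group1 // !conj1g.
exists z => //; rewrite inE Gz TI //; apply/trivgPn; exists (x ^ z).
  by rewrite inE Pxz memJ_conjg.
by rewrite conjg_eq1.
Qed.

(** Burnside's argument: [P] and [P :^ z] both lie in the centraliser of [x ^ z], and are conjugate
    there by Sylow's theorem. *)
Lemma abelian_Sylow_fusion (gT : finGroupType) (G P : {group gT}) p :
    p.-Sylow(G) P -> abelian P ->
  {in P & G, forall x z, x ^ z \in P -> exists2 n, n \in 'N_G(P) & x ^ z = x ^ n}.
Proof.
move=> sylP abP x z Px Gz Pxz; pose C := 'C_G[x ^ z]%G.
have [sPG pP _] := and3P sylP.
have sPC : P \subset C.
  by rewrite subsetI sPG; apply/subsetP=> u Pu; apply/cent1P/(centsP abP).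
have sPzC : P :^ z \subset C.
  rewrite subsetI; apply/andP; split; first by rewrite -(conjGid Gz) conjSg.
  apply/subsetP=> _ /imsetP[u Pu ->]; apply/cent1P.
  by rewrite /commute -!conjMg (centsP abP u Pu x Px).
have sylPC := pHall_subl sPC (subsetIl _ _) sylP.
have [|c Cc sPzPc] := Sylow_subJ sylPC sPzC; first by rewrite pgroupJ.
have [Gc cxz] := setIP Cc.
exists (z * c^-1); last first.
  by apply/esym; rewrite conjgM; apply/conjg_fixP/commgP/commuteV/commute_sym/cent1P.
rewrite inE groupM ?groupV //= inE conjsgM sub_conjgV.
exact: sPzPc.
Qed.

(** Schmidt's theorem. A minimal counterexample is simple, so normalisers of nontrivial
    [p]-subgroups are proper, hence nilpotent. This contradicts both alternatives of
    [Sylow_TI_or_local], the first one through transfer. *)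
Lemma min_nonnilpotent_sol (gT : finGroupType) (S : {group gT}) :
  (forall H : {group gT}, H \proper S -> nilpotent H) -> solvable S.
Proof.
have [n] := ubnP #|S|; elim: n gT S => // n IHn gT S leSn nilS.
apply: contraT => nsolS.
have ntS : S :!=: 1 by apply: contraNneq nsolS => ->; apply: solvable1.
have simS : simple S.
  apply/simpleP; split=> // N nsNS; have [sNS nNS] := andP nsNS.
  have [->|ntN] := eqVneq N 1%G; first by left.
  have [/val_inj->|neNS] := eqVneq (N : {set gT}) S; first by right.
  have prN : N \proper S by rewrite properEneq neNS.
  case/negP: nsolS; rewrite (series_sol nsNS) (nilpotent_sol (nilS N prN)) /=.
  apply: IHn => [|Hb prHb].
    by apply: leq_trans (ltn_quotient ntN sNS) _; rewrite -ltnS.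
  have [H defH sNH sHS] := inv_quotientS nsNS (proper_sub prHb).
  rewrite defH quotient_nil // nilS // properEneq sHS andbT.
  by apply: contraTneq prHb => eHS; rewrite defH eHS properxx.
have perfS := simple_nonsol_perfect simS nsolS.
have [P sylP] := Sylow_exists (pdiv #|S|) S.
have [sPS pP _] := and3P sylP.
have ntP : P :!=: 1.
  rewrite -cardG_gt1 (card_Hall sylP) p_part_gt1 pi_pdiv.
  by rewrite cardG_gt1.
have locS (D : {group gT}) : D \subset P -> D :!=: 1 -> nilpotent 'N_S(D).
  move=> sDP ntD; rewrite nilS // simple_local_proper ?(subset_trans sDP) //.
  exact: solvableS sDP (pgroup_sol pP).
have [TI | [D [ntD prD sylN /negP[]]]] := Sylow_TI_or_local sylP; last first.
  have nilN := locS D (proper_sub prD) ntD.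
  by rewrite (nilpotent_Hall_pcore nilN sylN) pcore_normal.
by have /negP[] := Sylow_perfect_norm_nonnil sylP perfS ntP (Sylow_TI_fusion TI);
  apply: locS.
Qed.

(** A normal subgroup [N] of prime index [q] is nilpotent, and its [q']-core [K] is a normal
    complement to a Sylow subgroup [Q] of [S]. Some Sylow subgroup [P] of [K] is not centralised by
    some [y] in [Q]; then [P <*> <[y]>] is not nilpotent, so it is all of [S]. *)
Lemma min_nonnilpotent_struct (gT : finGroupType) (S : {group gT}) :
    (forall H : {group gT}, H \proper S -> nilpotent H) -> ~~ nilpotent S ->
  exists p q (P : {group gT}) y, [/\ prime p, prime q & p != q] /\
    [/\ p.-Sylow(S) P, P <| S, q.-elt y, P ><| <[y]> = S & y \notin 'C(P)].
Proof.
move=> nilS nnS; have solS := min_nonnilpotent_sol nilS.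
have ntS : S :!=: 1 by apply: contraNneq nnS => ->; apply: nilpotent1.
have [N nsNS q_pr] := sol_prime_factor_exists solS ntS.
set q := #|S : N| in q_pr; have [sNS nNS] := andP nsNS.
have nilN : nilpotent N.
  apply: nilS; rewrite properEneq sNS andbT.
  by apply: contraTneq q_pr => eNS; rewrite /q eNS indexgg.
have [Q sylQ] := Sylow_exists q S; have [sQS qQ _] := and3P sylQ.
pose K := 'O_q^'(N)%G.
have hallKN : q^'.-Hall(N) K by apply: nilpotent_pcore_Hall.
have nsKS : K <| S by apply: gFnormal_trans.
have hallK : q^'.-Hall(S) K.
  rewrite /pHall (normal_sub nsKS) pcore_pgroup /=.
  rewrite -(Lagrange_index sNS (pcore_sub _ _)) pnatM -/q {1}/pnat.
  have [_ _] := and3P hallKN; rewrite pnatNK => ->; rewrite andbT.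
  by rewrite -/(pnat _ _) pnatNK pnat_id.
have defS : K ><| Q = S by apply/(sdprod_normal_pHallP nsKS sylQ).
have ncKQ : ~~ (K \subset 'C(Q)).
  apply: contra nnS => cKQ; have [_ <- _ _] := sdprodP defS.
  by rewrite mulg_nil 1?centsC // (nilpotentS (pcore_sub _ _) nilN) (pgroup_nil qQ).
have [P SylP ncPQ] : exists2 P : {group gT}, Sylow K P & ~~ (P \subset 'C(Q)).
  apply/exists_inP; apply: contraR ncKQ; rewrite negb_exists_in => /forall_inP cPQ.
  rewrite -[K : {set _}](Sylow_gen K) gen_subG; apply/bigcupsP=> P /cPQ.
  by rewrite negbK.
have [p p_pr sylP] := SylowP _ _ SylP; have [sPK pP _] := and3P sylP.
have nsPS : P <| S.
  have nilK : nilpotent K := nilpotentS (pcore_sub _ _) nilN.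
  by rewrite (nilpotent_Hall_pcore nilK sylP); apply: gFnormal_trans.
have [y Qy ncyP] : exists2 y, y \in Q & y \notin 'C(P).
  by apply/subsetPn; rewrite centsC.
have neqpq : p != q.
  apply: contraNneq ncPQ => epq; rewrite epq in pP.
  have q'P : q^'.-group P := pgroupS sPK (pcore_pgroup _ _).
  by have /card1_trivg-> : #|P| = 1%N := pnat_1 pP q'P; apply: sub1G.
have qy : q.-elt y := mem_p_elt qQ Qy.
have copy : coprime #|P| #|<[y]>|.
  exact: pnat_neq_coprime pP qy neqpq.
have nPy : <[y]> \subset 'N(P).
  by rewrite cycle_subG (subsetP (normal_norm nsPS)) // (subsetP sQS).
have defPy : P ><| <[y]> = P <*> <[y]> by rewrite sdprodEY ?coprime_TIg.
have eS : P <*> <[y]> = S.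
  apply/eqP; rewrite eqEproper join_subG normal_sub // cycle_subG (subsetP sQS) //=.
  apply/negP => /nilS nilPy; case/negP: ncyP.
  rewrite -cycle_subG (sub_nilpotent_cent2 nilPy) ?joing_subl ?joing_subr //.
rewrite eS in defPy; exists p, q, P, y; do 2!split=> //.
apply/and3P; split; rewrite ?normal_sub //.
rewrite -divgS ?normal_sub // -(sdprod_card defPy) mulKn //.
apply: sub_in_pnat qy => r _ /eqP->; by rewrite !inE eq_sym.
Qed.

(** If nontrivial, [[~: P, <[y]>]] would have elements of order [p]; these lie in ['Ohm_1(P)], but
    by coprime action the commutator group contains no nontrivial fixed point of [y]. *)
Lemma cyclic_coprime_cent (gT : finGroupType) (P : {group gT}) p y :
    p.-group P -> cyclic P -> y \in 'N(P) -> coprime #|P| #[y] ->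
  y \in 'C('Ohm_1(P)) -> y \in 'C(P).
Proof.
move=> pP cycP nPy copy cy1; rewrite -cycle_subG in nPy.
have TI := coprime_abel_cent_TI nPy copy (cyclic_abelian cycP).
rewrite -cycle_subG centsC; apply/commG1P.
suff: 'Ohm_1([~: P, <[y]>]) = 1 by move/eqP; rewrite Ohm1_eq1 => /eqP.
apply/trivgP; rewrite -TI subsetI Ohm_sub centsC.
have sRP : [~: P, <[y]>] \subset P by rewrite commg_subl.
by rewrite (subset_trans _ (centS (OhmS 1 sRP))) ?cycle_subG.
Qed.

Section SimpleWithNilpotentSecondMaximals.

Variables (gT : finGroupType) (G : {group gT}).
Hypotheses (simG : simple G) (nsolG : ~~ solvable G).
Hypothesis nil2 : forall H K : {group gT}, H \proper G -> K \proper H -> nilpotent K.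

Let pgroup_norm_proper (p : nat) (D : {group gT}) :
  p.-group D -> D \subset G -> D :!=: 1 -> 'N_G(D) \proper G.
Proof. by move=> pD sDG ntD; rewrite simple_local_proper // (pgroup_sol pD). Qed.

(** In the local alternative ['N_G(D)] is minimal non-nilpotent. Its Sylow subgroup [T = 'N_P(D)] is
    not normal, so it is conjugate to the cyclic factor. Then [D] is characteristic in [T], whence
    ['N_P(T)] is contained in ['N_P(D) = T] and [T = P]. *)
Lemma Sylow_TI_or_cyclic p (P : {group gT}) : p.-Sylow(G) P ->
  {in G, forall g, P :&: P :^ g != 1 -> g \in 'N(P)} \/ cyclic P.
Proof.
move=> sylP; have [sPG pP _] := and3P sylP.
have [|[D [ntD prD sylT nnT]]] := Sylow_TI_or_local sylP; [by left | right].
have sDP := proper_sub prD.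
pose N := 'N_G(D)%G; pose T := 'N_P(D)%G.
have prN : N \proper G.
  by rewrite (pgroup_norm_proper (pgroupS sDP pP)) ?(subset_trans sDP).
have nnN : ~~ nilpotent N.
  apply: contra nnT => nilN.
  by rewrite (nilpotent_Hall_pcore nilN sylT) pcore_normal.
have [p1 [q1 [P1 [y [[p1_pr q1_pr neq1] [sylP1 nsP1 qy defN _]]]]]] :=
  min_nonnilpotent_struct (fun K => @nil2 N K prN) nnN.
have ntT : T :!=: 1.
  by apply: subG1_contra ntD; rewrite subsetI sDP normG.
have pT : p.-group T := pHall_pgroup sylT.
have [p_pr p_T _] := pgroup_pdiv pT ntT.
have neqp1 : p1 != p.
  apply: contraNneq nnT => ep; rewrite ep in sylP1.
  suff -> : 'N_P(D) = P1 by [].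
  apply/eqP; rewrite eqEcard (sub_normal_Hall sylP1 nsP1) ?(pHall_sub sylT) // pT.
  by rewrite (card_Hall sylP1) (card_Hall sylT) leqnn.
have eqp : q1 = p.
  have : p %| #|N| by apply: dvdn_trans p_T (cardSg (pHall_sub sylT)).
  rewrite -(sdprod_card defN) Euclid_dvdM // => /orP[pP1|].
    have := pgroupP (pHall_pgroup sylP1) p p_pr pP1.
    by rewrite inE /= => /eqP ep; rewrite ep eqxx in neqp1.
  by move/(pgroupP qy p p_pr) => /eqP.
rewrite eqp in qy.
have sylY : p.-Sylow(N) <[y]>.
  have [nsP1N sYN _ _ _] := sdprod_context defN.
  rewrite /pHall sYN [_.-group _]qy -divgS // -(sdprod_card defN) mulnK ?order_gt0 //.
  apply: sub_in_pnat (pHall_pgroup sylP1) => r _ /eqP->.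
  by rewrite !inE.
have [x Nx defT] := Sylow_trans sylY sylT.
have cycT : cyclic T by rewrite /= defT cyclicJ cycle_cyclic.
have /= eqPT : P :=: T.
  apply: (nilpotent_sub_norm (pgroup_nil pP)); first exact: subsetIl.
  rewrite subsetI subsetIl /=; apply: subset_trans (subsetIr P _) _.
  apply: char_norms; rewrite sub_cyclic_char //.
  by rewrite subsetI sDP normG.
by rewrite eqPT.
Qed.

Lemma Sylow_norm_struct p (P : {group gT}) : p.-Sylow(G) P -> P :!=: 1 ->
  exists q y, [/\ prime p, prime q & p != q] /\
    [/\ q.-elt y, P ><| <[y]> = 'N_G(P), y \notin 'C(P),
     forall U : {group gT}, U \proper P -> y \in 'N(U) -> y \in 'C(U)
     & y ^+ q \in 'C(P)].
Proof.
move=> sylP ntP; have [sPG pP _] := and3P sylP.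
have perfG := simple_nonsol_perfect simG nsolG.
pose N := 'N_G(P)%G.
have prN : N \proper G by apply: pgroup_norm_proper pP sPG ntP.
have nnN : ~~ nilpotent N.
  apply: (Sylow_perfect_norm_nonnil sylP perfG ntP).
  have [TI|cycP] := Sylow_TI_or_cyclic sylP; first exact: Sylow_TI_fusion.
  exact: (abelian_Sylow_fusion sylP) (cyclic_abelian cycP).
have nsPN : P <| N by rewrite normalSG.
have sylPN : p.-Sylow(N) P by rewrite (pHall_subl _ _ sylP) ?subsetIl ?normal_sub.
have [p_pr p_P _] := pgroup_pdiv pP ntP.
have [p1 [q1 [P1 [y [[p1_pr q1_pr neq1] [sylP1 nsP1 qy defN ncy]]]]]] :=
  min_nonnilpotent_struct (fun K => @nil2 N K prN) nnN.
have [_ sYN _ _ _] := sdprod_context defN.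
(* If the normal factor [P1] were not the Sylow [p]-subgroup, then [y] would lie in [P], and [P] and
   [P1] would be normal of coprime orders, so [y] would centralise [P1]. *)
have eqp1 : p1 = p.
  apply/eqP; apply: contraR ncy => neqp1.
  have eqp : q1 = p.
    have : p %| #|N| by apply: dvdn_trans p_P (cardSg (normal_sub nsPN)).
    rewrite -(sdprod_card defN) Euclid_dvdM // => /orP[pP1|].
      have := pgroupP (pHall_pgroup sylP1) p p_pr pP1.
      by rewrite inE /= => /eqP ep; rewrite ep eqxx in neqp1.
    by move/(pgroupP qy p p_pr) => /eqP.
  rewrite -cycle_subG; apply: subset_trans (_ : P \subset _).
    by rewrite (sub_normal_Hall sylPN nsPN) // -eqp.
  rewrite (sameP commG1P trivgP).
  have sR : [~: P, P1] \subset P :&: P1.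
    rewrite subsetI commg_subl commg_subr.
    rewrite (subset_trans (normal_sub nsP1) (normal_norm nsPN)).
    by rewrite (subset_trans (normal_sub nsPN) (normal_norm nsP1)).
  apply: subset_trans sR _; rewrite coprime_TIg //.
  apply: pnat_neq_coprime pP (pHall_pgroup sylP1) _.
  by rewrite eq_sym.
rewrite {p1}eqp1 in p1_pr neq1 sylP1.
have eqP1 : P1 :=: P.
  apply/eqP; rewrite eqEcard (sub_normal_Hall sylPN nsPN) ?(pHall_sub sylP1) //.
  by rewrite (pHall_pgroup sylP1) (card_Hall sylP1) (card_Hall sylPN) leqnn.
rewrite {P1 sylP1 nsP1}eqP1 in defN ncy.
have Ny : y \in N by rewrite -cycle_subG.
have coPy : coprime #|P| #[y] by apply: pnat_neq_coprime pP qy neq1.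
have cardN := sdprod_card defN.
exists q1, y; split=> //; split=> // [U prU nUy|].
  have sUP := proper_sub prU.
  pose K := (U <*> <[y]>)%G.
  have prK : K \proper N.
    rewrite properEcard join_subG (subset_trans sUP (normal_sub nsPN)) sYN /=.
    rewrite norm_joinEr ?cycle_subG // -cardN.
    apply: leq_ltn_trans (_ : #|U| * #[y] < _).
      by rewrite TI_cardMg // coprime_TIg // (coprimeSg sUP).
    by rewrite ltn_pmul2r ?order_gt0 ?proper_card.
  rewrite -cycle_subG (sub_nilpotent_cent2 (nil2 prN prK)) ?joing_subl ?joing_subr //.
  exact: coprimeSg sUP coPy.
pose K := (P <*> <[y ^+ q1]>)%G.
have nty : y != 1 by apply: contraNneq ncy => ->; apply: group1.
have q_y : q1 %| #[y] by have [] := pgroup_pdiv qy; rewrite ?cycle_eq1.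
have co1 : coprime #|P| #[y ^+ q1].
  by apply: coprime_dvdr coPy; apply: orderXdvd.
have nPY : <[y ^+ q1]> \subset 'N(P).
  by rewrite cycle_subG groupX // (subsetP (normal_norm nsPN)).
have prK : K \proper N.
  rewrite properEcard join_subG (normal_sub nsPN) /= cycle_subG groupX //=.
  rewrite norm_joinEr // -cardN TI_cardMg ?coprime_TIg //.
  rewrite ltn_pmul2l // -orderE orderXdiv //.
  by rewrite ltn_Pdiv ?order_gt0 ?prime_gt1.
by rewrite -cycle_subG (sub_nilpotent_cent2 (nil2 prN prK)) ?joing_subl ?joing_subr.
Qed.

(** A cyclic [P] has order [p]: otherwise ['Ohm_1(P)] is proper and so centralised by [y], which
    then centralises [P]. Conjugates of a group of prime order meet trivially or coincide. *)
Lemma Sylow_TI p (P : {group gT}) : p.-Sylow(G) P -> P :!=: 1 ->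
  {in G, forall g, P :&: P :^ g != 1 -> g \in 'N(P)}.
Proof.
move=> sylP ntP; have [//|cycP] := Sylow_TI_or_cyclic sylP.
have [sPG pP _] := and3P sylP.
have [q [y [[p_pr q_pr neqpq] [qy defN ncy cU _]]]] := Sylow_norm_struct sylP ntP.
have [_ sYN _ _ _] := sdprod_context defN.
have nPy : y \in 'N(P) by have /setIP[] : y \in 'N_G(P) by rewrite -cycle_subG.
have coPy : coprime #|P| #[y] by apply: pnat_neq_coprime pP qy neqpq.
have prP : prime #|P|.
  suff <- : #|'Ohm_1(P)| = #|P| by rewrite (Ohm1_cyclic_pgroup_prime cycP pP).
  apply/eqP; rewrite eqn_leq subset_leq_card ?Ohm_sub //= leqNgt.
  apply: contra ncy => ltP; apply: (cyclic_coprime_cent pP cycP nPy coPy).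
  apply: cU; first by rewrite properEcard Ohm_sub.
  by rewrite (subsetP (char_norms (Ohm_char 1 P))).
move=> g Gg /(prime_meetG prP) sPPg.
by rewrite -groupV inE sub_conjgV.
Qed.

Lemma Sylow_normedTI p (P : {group gT}) :
  p.-Sylow(G) P -> P :!=: 1 -> normedTI P^# G 'N_G(P).
Proof.
move=> sylP ntP; apply/normedTI_memJ_P; split.
- by rewrite setD_eq0 subG1.
- exact: subsetIl.
move=> a g /setD1P[nta Pa] Gg; rewrite !inE conjg_eq1 nta Gg /=.
apply/idP/idP => [Pag | sPgP]; last by rewrite (subsetP sPgP) ?memJ_conjg.
have : g \in 'N(P); last by rewrite inE.
apply: (Sylow_TI sylP ntP Gg); apply/trivgPn; exists (a ^ g).
  by rewrite inE Pag memJ_conjg.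
by rewrite conjg_eq1.
Qed.

Lemma Sylow_norm_prime p (P : {group gT}) : p.-Sylow(G) P -> P :!=: 1 ->
  exists y, [/\ prime p, prime #[y] & p != #[y]] /\
    [/\ P ><| <[y]> = 'N_G(P), y \notin 'C(P)
     & forall U : {group gT}, U \proper P -> y \in 'N(U) -> y \in 'C(U)].
Proof.
move=> sylP ntP; have [sPG pP _] := and3P sylP.
have [q [y [[p_pr q_pr neqpq] [qy defN ncy cU cyq]]]] := Sylow_norm_struct sylP ntP.
have [_ sYN _ _ _] := sdprod_context defN.
have nty : y != 1 by apply: contraNneq ncy => ->; apply: group1.
have [nPy Gy] : y \in 'N(P) /\ y \in G.
  by have /setIP[] : y \in 'N_G(P) by rewrite -cycle_subG.
suff oy : #[y] = q by exists y; rewrite oy.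
have yq1 : y ^+ q = 1.
  apply: contraNeq ncy => ntyq.
  have sYG : <[y]> \subset G by rewrite cycle_subG.
  have [Q sylQ sYQ] := Sylow_superset sYG qy.
  have Qy : y \in Q by rewrite -cycle_subG.
  have ntQ : Q :!=: 1 by apply/trivgPn; exists y.
  have /normedTI_memJ_P[_ _ tiQ] := Sylow_normedTI sylQ ntQ.
  have nQP : P \subset 'N(Q).
    apply/subsetP=> u Pu; have: u \in 'N_G(Q); last by case/setIP.
    have Qyq : y ^+ q \in Q^# by rewrite !inE ntyq groupX.
    rewrite -(tiQ _ _ Qyq (subsetP sPG u Pu)).
    by rewrite conjgE (centP cyq u Pu) mulKg !inE ntyq groupX.
  rewrite -cycle_subG centsC; apply/commG1P/trivgP.
  have <- : P :&: Q = 1 by rewrite coprime_TIg ?(pnat_neq_coprime pP (pHall_pgroup sylQ)).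
  rewrite subsetI commg_subl cycle_subG nPy /=.
  by rewrite (subset_trans (commgS P sYQ)) // commg_subr.
apply/(prime_nt_dvdP q_pr); first by rewrite order_eq1.
by rewrite order_dvdn yq1.
Qed.

(** A nontrivial [x] in [P] commuting with [y] normalises the Sylow [q]-subgroup [Q] containing [y],
    so the roles of the two primes become symmetric: ['N_G(Q)] has a complement of order [p]. Then
    ['N_G(P) :&: 'N_G(Q)] has order [p * q], and the conjugates of its elements of order [p * q],
    with those of [P] and [Q], overfill [G]. *)
Lemma Sylow_norm_regular p (P : {group gT}) y :
    p.-Sylow(G) P -> P ><| <[y]> = 'N_G(P) -> prime #[y] -> p != #[y] ->
  y \notin 'C(P) -> 'C_P[y] = 1.
Proof.
move=> sylP defNP q_pr neqpq ncyP; have [sPG pP _] := and3P sylP.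
set q := #[y] in q_pr neqpq.
apply/trivgP/subsetP=> x /setIP[Px cyx]; apply: contraR ncyP => ntx; rewrite inE in ntx.
have ntP : P :!=: 1 by apply/trivgPn; exists x.
have [p_pr _ _] := pgroup_pdiv pP ntP.
have [nsPN sYN _ _ _] := sdprod_context defNP.
have [Gy nPy] : y \in G /\ y \in 'N(P).
  by have /setIP[] : y \in 'N_G(P) by rewrite -cycle_subG.
have nty : y != 1 by rewrite -order_gt1 prime_gt1.
have qy : q.-elt y by rewrite /p_elt pnat_id.
have sYG : <[y]> \subset G by rewrite cycle_subG.
have [Q sylQ sYQ] := Sylow_superset sYG qy; have [sQG qQ _] := and3P sylQ.
have Qy : y \in Q by rewrite -cycle_subG.
have ntQ : Q :!=: 1 by apply/trivgPn; exists y.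
have Gx : x \in G := subsetP sPG x Px.
have cxy : commute x y by apply/cent1P.
have TIP := Sylow_normedTI sylP ntP; have /normedTI_memJ_P[_ _ tiP] := TIP.
have TIQ := Sylow_normedTI sylQ ntQ; have /normedTI_memJ_P[_ _ tiQ] := TIQ.
have Nx : x \in 'N_G(Q).
  by rewrite -(tiQ y) // ?conjgE -?cxy ?mulKg !inE nty.
have [z [[_ r_pr neqqr] [defNQ nczQ _]]] := Sylow_norm_prime sylQ ntQ.
have [nsQN sZN _ _ _] := sdprod_context defNQ.
have coPQ : coprime #|P| #|Q| := pnat_neq_coprime pP qQ neqpq.
have cardNP := sdprod_card defNP; have cardNQ := sdprod_card defNQ.
have px : p.-elt x := mem_p_elt pP Px.
have p_x : p %| #[x].
  by have [] := pgroup_pdiv px; rewrite ?cycle_eq1.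
have er : #[z] = p.
  have : p %| #|'N_G(Q)| by apply: dvdn_trans p_x (order_dvdG Nx).
  rewrite -cardNQ Euclid_dvdM // -orderE (dvdn_prime2 p_pr r_pr) => /orP[pQ|/eqP->//].
  have := pgroupP qQ p p_pr pQ; rewrite inE /= => /eqP epq.
  by rewrite epq eqxx in neqpq.
rewrite -orderE er in cardNQ; rewrite -orderE -/q in cardNP.
have defPN : P :&: 'N_G(Q) = <[x]>.
  apply/eqP; rewrite eq_sym eqEcard cycle_subG inE Px Nx /=.
  apply: dvdn_leq (order_gt0 x) _; apply: dvdn_trans p_x.
  rewrite -(@Gauss_dvdr _ #|Q|); last by rewrite (coprimeSg (subsetIl _ _)).
  by rewrite cardNQ cardSg ?subsetIr.
have ox : #[x] = p.
  apply/eqP; rewrite eqn_leq (dvdn_leq _ p_x) // andbT; apply: dvdn_leq (prime_gt0 p_pr) _.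
  rewrite -(@Gauss_dvdr _ #|Q|); last by apply: coprime_dvdl coPQ; apply: order_dvdG.
  by rewrite cardNQ order_dvdG.
have defQN : Q :&: 'N_G(P) = <[y]>.
  apply/eqP; rewrite eq_sym eqEcard cycle_subG inE Qy -cycle_subG sYN /=.
  apply: dvdn_leq (order_gt0 y) _.
  rewrite -(@Gauss_dvdr _ #|P|) -/q ?cardNP ?cardSg ?subsetIr //.
  by rewrite coprime_sym (coprimegS (subsetIl _ _)).
pose L := ('N_G(P) :&: 'N_G(Q))%G.
have Lx : x \in L by rewrite inE Nx (subsetP (normal_sub nsPN)).
have Ly : y \in L by rewrite inE -cycle_subG sYN (subsetP (normal_sub nsQN)).
have cardL : #|L| = (p * q)%N.
  apply/eqP; rewrite eqn_leq; apply/andP; split.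
    have nPL : L \subset 'N(P) by rewrite subIset // subsetIr.
    rewrite -(Lagrange (subsetIr P L)); apply: leq_mul.
      by rewrite -ox orderE -defPN subset_leq_card // setIS // subsetIr.
    rewrite -card_quotient; last by rewrite normsI ?normG.
    rewrite (card_isog (second_isog nPL)) /=.
    apply: leq_trans (subset_leq_card (quotientS P (subsetIl _ _))) _.
    by rewrite card_quotient ?subsetIr // -divgS ?normal_sub // -cardNP mulKn.
  rewrite dvdn_leq // Gauss_dvd ?prime_coprime ?(dvdn_prime2 p_pr q_pr) //.
  by rewrite -{1}ox /q !order_dvdG.
pose A := L :\: (P :|: Q).
have cardA : #|A| = (p.-1 * q.-1)%N.
  have eI : L :&: (P :|: Q) = <[x]> :|: <[y]>.
    rewrite setIUr; congr (_ :|: _).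
      by rewrite /= setIAC (setIidPr (normal_sub nsPN)) defPN.
    by rewrite /= -setIA (setIidPr (normal_sub nsQN)) setIC defQN.
  rewrite cardsD eI cardsU cardL -!orderE ox -/q.
  have -> : <[x]> :&: <[y]> = 1.
    by rewrite coprime_TIg // (coprimeSg _ (coprimegS sYQ coPQ)) ?cycle_subG.
  rewrite cards1; have := prime_gt0 p_pr; have := prime_gt0 q_pr; clear.
  by case: p q => [|p'] [|q'] //= _ _; nia.
have sLG : L \subset G by rewrite !subIset ?subxx.
have [p_gt1 q_gt1] := (prime_gt1 p_pr, prime_gt1 q_pr).
have sylPN : p.-Sylow('N_G(P)) P by rewrite (pHall_subl _ _ sylP) ?subsetIl ?normal_sub.
have sylQN : q.-Sylow('N_G(Q)) Q by rewrite (pHall_subl _ _ sylQ) ?subsetIl ?normal_sub.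
have memP u : u \in L -> (u \in P) = p.-elt u.
  by case/setIP=> Nu _; rewrite (mem_normal_Hall sylPN nsPN).
have memQ u : u \in L -> (u \in Q) = q.-elt u.
  by case/setIP=> _ Nu; rewrite (mem_normal_Hall sylQN nsQN).
have pqL u : u \in L -> #[u] %| (p * q)%N by rewrite -cardL; apply: order_dvdG.
have consttA u : u \in A -> u.`_p \in P^# /\ u.`_q \in Q^#.
  case/setDP=> Lu; rewrite inE negb_or memP // memQ // => /andP[npu nqu].
  have Lup : u.`_p \in L by rewrite groupX.
  have Luq : u.`_q \in L by rewrite groupX.
  rewrite !inE memP // memQ // !p_elt_constt !andbT; split.
    apply: contra nqu => /eqP/constt1P p'u.
    have : #[u] %| q.
      rewrite -(@Gauss_dvdr _ p) ?pqL // coprime_sym.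
      by apply: (pnat_coprime _ p'u); rewrite pnat_id.
    by rewrite /p_elt; move/(pnat_dvd)->; rewrite ?pnat_id.
  apply: contra npu => /eqP/constt1P q'u.
  have : #[u] %| p.
    rewrite -(@Gauss_dvdl _ _ q) ?pqL // coprime_sym.
    by apply: (pnat_coprime _ q'u); rewrite pnat_id.
  by rewrite /p_elt; move/(pnat_dvd)->; rewrite ?pnat_id.
(* The [p]-part and [q]-part of an element of [A] are nontrivial elements of [P] and [Q], so an
   element conjugating it into [A] normalises both. *)
have TIA : normedTI A G L.
  apply/normedTI_memJ_P; split=> //.
    by rewrite -card_gt0 cardA muln_gt0 -!subn1 !subn_gt0 p_gt1.
  move=> a g Aa Gg; apply/idP/idP => [Aag | Lg].
    have [Pa Qa] := consttA a Aa; have [Pag Qag] := consttA _ Aag.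
    by rewrite inE -(tiP _ _ Pa Gg) -(tiQ _ _ Qa Gg) -!consttJ Pag.
  have [La nPQa] := setDP Aa; have /setIP[/setIP[_ nPg] /setIP[_ nQg]] := Lg.
  by rewrite inE groupJ // inE !memJ_norm // -in_setU nPQa.
have eltP u : u \in class_support P^# G -> p.-elt u /\ u != 1.
  case/imset2P=> v g /setD1P[ntv Pv] _ ->; rewrite conjg_eq1 ntv.
  by split=> //; rewrite /p_elt orderJ; apply: mem_p_elt pP Pv.
have eltQ u : u \in class_support Q^# G -> q.-elt u /\ u != 1.
  case/imset2P=> v g /setD1P[ntv Qv] _ ->; rewrite conjg_eq1 ntv.
  by split=> //; rewrite /p_elt orderJ; apply: mem_p_elt qQ Qv.
have eltA u : u \in class_support A G -> [/\ ~~ p.-elt u, ~~ q.-elt u & u != 1].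
  case/imset2P=> v g Av _ ->; rewrite conjg_eq1 /p_elt orderJ.
  have [Lv] := setDP Av; rewrite inE negb_or memP // memQ // => /andP[npv nqv].
  by split=> //; apply: contraNneq npv => ->; rewrite /p_elt order1.
have sum_le : #|class_support P^# G| + #|class_support Q^# G| + #|class_support A G| < #|G|.
  have tiPQ : class_support P^# G :&: class_support Q^# G = set0.
    apply/setP=> u; rewrite !inE; apply/andP=> -[/eltP[pu ntu] /eltQ[qu _]].
    have := pnat_neq_coprime pu qu neqpq; rewrite /coprime gcdnn order_eq1.
    by apply/negP.
  have tiPQA : (class_support P^# G :|: class_support Q^# G) :&: class_support A G = set0.
    apply/setP=> u; rewrite !inE; apply/andP=> -[/orP[/eltP[pu _]|/eltQ[qu _]] /eltA[]].
      by rewrite pu.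
    by rewrite qu.
  have cardUd (B C : {set gT}) : B :&: C = set0 -> #|B| + #|C| = #|B :|: C|.
    by move=> tiBC; rewrite cardsU tiBC cards0 subn0.
  rewrite (cardUd _ _ tiPQ) (cardUd _ _ tiPQA).
  rewrite (cardsD1 1 G) group1 add1n ltnS subset_leq_card //.
  apply/subsetP=> u; rewrite !inE => Uu; apply/andP; split.
    by case/orP: Uu => [/orP[/eltP[]|/eltQ[]]|/eltA[]].
  have clG (B : {set gT}) : B \subset G -> u \in class_support B G -> u \in G.
    by move=> sBG; apply: subsetP; rewrite class_support_sub_norm ?normG.
  case/orP: Uu => [/orP[]|]; apply: clG.
  - by rewrite subDset setUC subsetU ?sPG.
  - by rewrite subDset setUC subsetU ?sQG.
  - by rewrite subDset setUC subsetU ?sLG.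
(* The count needs both Sylow subgroups to exceed prime order. If [#|P| = p] then [P = <[x]>] is
   centralised by [y]; if [#|Q| = q] then ['N_G(Q) = Q * <[x]>] centralises [Q], against the choice
   of [z]. *)
have [P1|neP] := eqVneq #|P| p.
  have -> : P :=: <[x]>; last by rewrite cent_cycle cent1C.
  by apply/eqP; rewrite eq_sym eqEcard cycle_subG Px P1 -orderE ox leqnn.
have neQ : #|Q| != q.
  apply: contraNneq nczQ => oQ.
  have defQ : Q :=: <[y]>.
    by apply/eqP; rewrite eq_sym eqEcard cycle_subG Qy oQ -orderE leqnn.
  have cQx : <[x]> \subset 'C(Q) by rewrite defQ cent_cycle cycle_subG.
  have : z \in Q * <[x]>.
    have -> : Q * <[x]> = 'N_G(Q).
      apply/eqP; rewrite eqEcard mul_subG ?cycle_subG ?normal_sub //=.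
      rewrite TI_cardMg -?cardNQ -?orderE ?ox // coprime_TIg // coprime_sym.
      by rewrite (coprimeSg _ coPQ) ?cycle_subG.
    by rewrite -cycle_subG.
  case/mulsgP=> u v Qu xv ->; rewrite groupM //; last exact: (subsetP cQx).
  have abQ : abelian Q by rewrite defQ cycle_abelian.
  exact: (subsetP abQ).
have divP : exists2 a, #|P| = (p * a)%N & 1 < a.
  have [_ p_P [n oP]] := pgroup_pdiv pP ntP; exists (p ^ n)%N; first by rewrite oP expnS.
  case: n oP neP => [-> | n _ _]; first by rewrite expn1 eqxx.
  by rewrite -{1}(exp1n n.+1) ltn_exp2r.
have divQ : exists2 b, #|Q| = (q * b)%N & 1 < b.
  have [_ q_Q [n oQ]] := pgroup_pdiv qQ ntQ; exists (q ^ n)%N; first by rewrite oQ expnS.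
  case: n oQ neQ => [-> | n _ _]; first by rewrite expn1 eqxx.
  by rewrite -{1}(exp1n n.+1) ltn_exp2r.
have [a oP a_gt1] := divP; have [b oQ b_gt1] := divQ.
move: sum_le; rewrite (card_support_normedTI TIP) (card_support_normedTI TIQ).
rewrite (card_support_normedTI TIA) cardA.
rewrite -[X in _ < X -> _](Lagrange sLG) cardL.
have eP := Lagrange (subsetIl G 'N(P)); have eQ := Lagrange (subsetIl G 'N(Q)).
have eL := Lagrange sLG; move: eP eQ; rewrite -{}eL -cardNP -cardNQ cardL oP oQ.
have := cardsD1 1 P; have := cardsD1 1 Q; rewrite !group1 oP oQ !add1n.
move=> eQ' eP' eP eQ lt_sum; apply: False_ind.
apply: (mixed_count_absurd p_gt1 q_gt1 a_gt1 b_gt1 (indexg_gt0 G L) eP' eQ' eP eQ).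
by rewrite mulnAC (mulnAC _ _ #|G : L|) in lt_sum *; rewrite -mulnA in lt_sum *.
Qed.

Lemma Sylow_local_structure p (P : {group gT}) : p.-Sylow(G) P -> P :!=: 1 ->
  exists y, [/\ prime p, prime #[y], p != #[y] & [Frobenius 'N_G(P) = P ><| <[y]>]] /\
    [/\ abelian P, {in P^#, forall x, 'C_G[x] = P}
     & forall U : {group gT}, U \subset P -> y \in 'N(U) -> U :=: 1 \/ U :=: P].
Proof.
move=> sylP ntP; have [sPG pP _] := and3P sylP.
have [y [[p_pr q_pr neqpq] [defN ncy cU]]] := Sylow_norm_prime sylP ntP.
have Cy1 := Sylow_norm_regular sylP defN q_pr neqpq ncy.
(* A proper [y]-invariant subgroup is centralised by [y], which has no nontrivial fixed point in
   [P]. Applied to the derived subgroup, this makes [P] abelian. *)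
have minP (U : {group gT}) : U \subset P -> y \in 'N(U) -> U :=: 1 \/ U :=: P.
  move=> sUP nUy; have [-> | neUP] := eqVneq (U : {set gT}) P; first by right.
  left; apply/trivgP; rewrite -Cy1 subsetI sUP -cent_cycle centsC cycle_subG.
  by rewrite cU // properEneq neUP.
have frobN : [Frobenius 'N_G(P) = P ><| <[y]>].
  by apply/prime_FrobeniusP; rewrite -?orderE // cent_cycle.
have [_ sYN _ _ _] := sdprod_context defN.
have nPy : y \in 'N(P) by have /setIP[] : y \in 'N_G(P) by rewrite -cycle_subG.
have abP : abelian P.
  apply/derG1P; have [|//|P'P] := minP P^`(1)%G (der_sub 1 P).
    by rewrite (subsetP (char_norms (der_char 1 P))).
  have := sol_der1_proper (pgroup_sol pP) (subxx P) ntP.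
  by rewrite [P^`(1)]P'P properxx.
exists y; split=> //; split=> // x Px; apply/eqP; rewrite eqEsubset; apply/andP; split.
  have sCN := cent1_normedTI (Sylow_normedTI sylP ntP) Px.
  apply: subset_trans (Frobenius_cent1_ker frobN Px).
  by rewrite subsetI sCN subsetIr.
rewrite subsetI sPG; apply/subsetP=> u Pu; apply/cent1P.
by case/setD1P: Px => _ Px; apply: (centsP abP).
Qed.

End SimpleWithNilpotentSecondMaximals.

(** * Even order *)

Lemma sum_class_support (gT : finGroupType) (A : {set gT}) (G L : {group gT})
    (R : nmodType) (F : gT -> R) :
    normedTI A G L -> {in G, forall g x, F (x ^ g) = F x} ->
  (\sum_(x in class_support A G) F x = (\sum_(x in A) F x) *+ #|G : L|)%R.
Proof.
move=> TIA FJ; have /and3P[ntA tiA /eqP defL] := TIA.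
have partA := partition_normedTI TIA.
rewrite (set_partition_big _ partA) /= -defL -card_conjugates -GRing.sumr_const.
apply: eq_bigr => _ /imsetP[g Gg ->].
rewrite big_imset /=; last by move=> x y _ _; apply: conjg_inj.
by apply: eq_bigr => x _; rewrite FJ.
Qed.

Lemma cardsD1_pred (gT : finGroupType) (H : {group gT}) : #|H^#| = #|H|.-1.
Proof. by rewrite (cardsD1 1 H) group1. Qed.

Definition aSylow (gT : finGroupType) (G : {group gT}) p : {group gT} :=
  sval (Sylow_exists p G).

(** * The partition of a simple group by the conjugates of its Sylow subgroups *)

Section SylowPartition.

Variables (gT : finGroupType) (G : {group gT}).
Hypotheses (simG : simple G) (nsolG : ~~ solvable G).
Hypothesis nil2 : forall H K : {group gT}, H \proper G -> K \proper H -> nilpotent K.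

Local Notation A := (aSylow G).

Lemma aSylowP p : p.-Sylow(G) (A p).
Proof. by rewrite /aSylow; case: (Sylow_exists p G). Qed.

Lemma aSylow_neq1 p : p \in primes #|G| -> A p :!=: 1.
Proof. by move=> piGp; rewrite -cardG_gt1 (card_Hall (aSylowP p)) p_part_gt1. Qed.

Lemma aSylow_elt p x : x \in class_support (A p)^# G -> p.-elt x /\ x != 1.
Proof.
case/imset2P=> v g /setD1P[ntv Av] _ ->; rewrite conjg_eq1 ntv /p_elt orderJ.
by split=> //; apply: mem_p_elt (pHall_pgroup (aSylowP p)) Av.
Qed.

(** A nontrivial primary part of [x] is conjugate into some [A p], where it has centraliser [A p];
    and [x] commutes with its primary parts. *)
Lemma aSylow_cover x :
  x \in G^# -> exists2 p, p \in primes #|G| & x \in class_support (A p)^# G.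
Proof.
case/setD1P=> ntx Gx; pose p := pdiv #[x].
have p_pr : prime p by rewrite pdiv_prime ?order_gt1.
have piGp : p \in primes #|G|.
  by rewrite mem_primes p_pr cardG_gt0 (dvdn_trans (pdiv_dvd _)) ?order_dvdG.
exists p => //; have sylA := aSylowP p; have ntA := aSylow_neq1 piGp.
have [y [_ [_ CA _]]] := Sylow_local_structure simG nsolG nil2 sylA ntA.
have ntxp : x.`_p != 1.
  apply: contraTneq (pdiv_dvd #[x]) => /constt1P p'x; rewrite -/p -prime_coprime //.
  by apply: pnat_coprime p'x; rewrite pnat_id.
have [|g Gg sxA] := Sylow_subJ sylA (_ : <[x.`_p]> \subset G) (p_elt_constt p x).
  by rewrite cycle_subG groupX.
have Axp : x.`_p ^ g^-1 \in (A p)^#.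
  by rewrite !inE conjg_eq1 ntxp -mem_conjg -cycle_subG.
apply/imset2P; exists (x ^ g^-1) g; rewrite ?conjgKV // !inE conjg_eq1 ntx /=.
rewrite -(CA _ Axp) inE groupJ ?groupV //= cent1J memJ_conjg.
by apply/cent1P; apply: (commuteX _ (commute_refl x)).
Qed.

(** Used three times: for the count of pairs of involutions, the norm of an irreducible character
    and the class equation. *)
Lemma sum_over_Sylows (R : nmodType) (F : gT -> R) :
    {in G, forall g x, F (x ^ g) = F x} ->
  (\sum_(x in G) F x =
   F 1%g + \sum_(p <- primes #|G|) (\sum_(x in (A p)^#) F x) *+ #|G : 'N_G(A p)|)%R.
Proof.
move=> FJ; rewrite (big_setD1 1%g) //=; congr (_ + _)%R.
transitivity (\sum_(p <- primes #|G|) \sum_(x in class_support (A p)^# G) F x)%R.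
  rewrite (exchange_big_dep (mem G^#)) /=; last first.
    move=> p x _ Ax; have [_ ntx] := aSylow_elt Ax; rewrite !inE ntx.
    apply: subsetP Ax; rewrite class_support_sub_norm ?normG //.
    by rewrite subDset setUC subsetU // (pHall_sub (aSylowP p)).
  apply: eq_bigr => x Gx; have [p piGp Ax] := aSylow_cover Gx.
  rewrite big_mkcond (bigD1_seq p) ?primes_uniq //= Ax big1_seq ?GRing.addr0 // => r.
  case/andP=> neqrp _; case: ifP => // Arx; have [px ntx] := aSylow_elt Ax.
  have [rx _] := aSylow_elt Arx.
  have := pnat_neq_coprime rx px neqrp; rewrite /coprime gcdnn order_eq1.
  by rewrite (negPf ntx).
rewrite [LHS]big_seq [RHS]big_seq; apply: eq_bigr => p piGp.
by apply: sum_class_support => //; apply: Sylow_normedTI (aSylowP p) (aSylow_neq1 piGp).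
Qed.

End SylowPartition.

Section EvenOrder.

Variables (gT : finGroupType) (G : {group gT}).
Hypotheses (simG : simple G) (nsolG : ~~ solvable G).
Hypothesis nil2 : forall H K : {group gT}, H \proper G -> K \proper H -> nilpotent K.

Local Notation A := (aSylow G).

(** Here [y] has order 2 and [a * a ^ y] is fixed by [y], hence trivial, so [y] inverts [P]. Every
    cyclic subgroup is then [y]-invariant, and [P] has no proper nontrivial one. *)
Lemma inverted_Sylow p (P : {group gT}) :
    p.-Sylow(G) P -> P :!=: 1 -> #|'N_G(P)| = (2 * #|P|)%N ->
  [/\ odd p, #|P| = p & {in P & 'N_G(P) :\: P, forall a t, a ^ t = a^-1 /\ t ^+ 2 = 1}].
Proof.
move=> sylP ntP oN; have [sPG pP _] := and3P sylP.
have [y [[p_pr q_pr neqpq frobN] [abP CP minP]]] :=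
  Sylow_local_structure simG nsolG nil2 sylP ntP.
have [defN _ _ _ _] := Frobenius_context frobN.
have [nsPN sYN defNm nPy tiPy] := sdprod_context defN.
have oy : #[y] = 2.
  apply/eqP; rewrite -(eqn_pmul2l (cardG_gt0 P)) orderE (sdprod_card defN) oN.
  by rewrite mulnC.
have p_odd : odd p by case: (even_prime p_pr) => // ep; rewrite ep oy in neqpq.
have Cy1 : 'C_P[y] = 1 by have := Frobenius_trivg_cent frobN; rewrite cent_cycle.
have y2 : y * y = 1 by rewrite -[y * y]/(y ^+ 2) -oy expg_order.
have yV : y^-1 = y by apply/eqP; rewrite eq_invg_mul y2.
have inv_y a : a \in P -> a ^ y = a^-1.
  move=> Pa; have Pay : a ^ y \in P.
    by rewrite memJ_norm // (subsetP nPy) ?cycle_id.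
  have : a * a ^ y \in 'C_P[y].
    rewrite inE groupM //=; apply/cent1P/commgP/conjg_fixP.
    by rewrite conjMg -conjgM y2 conjg1 (centsP abP).
  by rewrite Cy1 => /set1P/eqP; rewrite -eq_invg_mul => /eqP.
have oP : #|P| = p.
  have [_ p_P _] := pgroup_pdiv pP ntP; have [a Pa oa] := Cauchy p_pr p_P.
  have saP : <[a]> \subset P by rewrite cycle_subG.
  have [|a1|<-] := minP <[a]>%G saP; last by rewrite -orderE.
    by rewrite inE /= -cycleJ inv_y // cycleV.
  by move/eqP: a1; rewrite /= cycle_eq1 -order_eq1 oa; case: (p) p_pr => [|[]].
split=> // a t Pa /setDP[]; rewrite -defNm => /mulsgP[b u Pb yu ->] nPt.
have eu : u = y.
  move: yu; rewrite /= cycle2g ?oy // inE => /orP[|]/set1P // u1.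
  by rewrite u1 mulg1 Pb in nPt.
rewrite {u yu nPt}eu; split.
  rewrite conjgM inv_y ?groupJ //; congr _^-1.
  by rewrite conjgE (centsP abP a Pa b Pb) mulKg.
have : b ^ y = b^-1 := inv_y b Pb; rewrite conjgE yV => eb.
by rewrite -[LHS]/(b * y * (b * y)) -mulgA eb mulgV.
Qed.

Lemma Sylow_elementary p (P : {group gT}) :
  p.-Sylow(G) P -> P :!=: 1 -> {in P, forall t, t ^+ p = 1}.
Proof.
move=> sylP ntP; have pP := pHall_pgroup sylP.
have [y [[p_pr _ _ frobN] [abP _ minP]]] :=
  Sylow_local_structure simG nsolG nil2 sylP ntP.
have [defN _ _ _ _] := Frobenius_context frobN.
have [_ sYN _ _ _] := sdprod_context defN.
have nPy : y \in 'N(P) by have /setIP[] : y \in 'N_G(P) by rewrite -cycle_subG.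
have [|O1|O1] := minP 'Ohm_1(P)%G (Ohm_sub 1 _).
- by rewrite (subsetP (char_norms (Ohm_char 1 _))).
- by move: ntP; rewrite -Ohm1_eq1 O1 eqxx.
have : p.-abelem P by rewrite -O1 (Ohm1_abelem pP).
by rewrite (abelemE _ p_pr) => /andP[_ /exponentP].
Qed.

Local Notation I := (class_support (A 2)^# G).

Lemma class_support_memJ (B : {set gT}) t g :
  g \in G -> (t ^ g \in class_support B G) = (t \in class_support B G).
Proof.
by move=> Gg; rewrite memJ_norm // (subsetP (class_support_norm _ _)).
Qed.

Hypothesis G2 : 2 %| #|G|.

Let sylA2 := aSylowP G 2.
Let piG2 : 2 \in primes #|G|. Proof. by rewrite mem_primes cardG_gt0. Qed.
Let ntA2 := aSylow_neq1 piG2.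
Let sIG : I \subset G.
Proof.
by rewrite class_support_sub_norm ?normG // subDset setUC subsetU ?(pHall_sub sylA2).
Qed.

Lemma aSylow2_involution t : t \in I -> t ^+ 2 = 1.
Proof.
case/imset2P=> u g /setD1P[_ Au] _ ->.
by rewrite -conjXg (Sylow_elementary sylA2) ?conj1g.
Qed.

Lemma involution_aSylow2 t : t \in G -> t != 1 -> t ^+ 2 = 1 -> t \in I.
Proof.
move=> Gt ntt t2; have [|p piGp It] := aSylow_cover simG nsolG nil2 (_ : t \in G^#).
  by rewrite !inE ntt.
have [pt _] := aSylow_elt It.
suff -> : 2 = p by [].
have p_pr : prime p by move: piGp; rewrite mem_primes => /andP[].
have : p %| #[t] by have [] := pgroup_pdiv pt; rewrite ?cycle_eq1.
move/dvdn_trans => /(_ 2); rewrite order_dvdn t2 eqxx => /(_ isT).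
by rewrite dvdn_prime2 // => /eqP.
Qed.

Lemma card_commuting_involutions t : t \in I -> #|I :&: 'C[t]| = #|(A 2)^#|.
Proof.
have [y [_ [abA CA _]]] := Sylow_local_structure simG nsolG nil2 sylA2 ntA2.
case/imset2P=> u g Au Gg ->; rewrite -(cardJg (A 2)^# g); apply: eq_card => v.
have defA : A 2 :^ g = 'C_G[u ^ g] by rewrite -(CA u Au) conjIg conjGid // -cent1J.
rewrite conjD1g defA in_setI in_setD1 in_setI; case Cv: (v \in 'C[u ^ g]); last by rewrite !andbF.
rewrite !andbT; apply/idP/andP=> [Iv | [ntv Gv]].
  by have [_ ->] := aSylow_elt Iv; rewrite (subsetP sIG).
have : v ^ g^-1 \in 'C_G[u] by rewrite inE groupJ ?groupV // -mem_conjg -cent1J.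
rewrite CA // => Av; rewrite -(conjgKV g v) class_support_memJ //.
by apply: (subsetP (sub_class_support _ _)); rewrite !inE conjg_eq1 ntv.
Qed.

(* [F x] counts the ways to write [x] as a product of two involutions that do
   not commute; these lie in distinct Sylow 2-subgroups. *)
Local Notation F x := (#|[set t in I | (t * x \in I) && (t * x \notin 'C[t])]|).

Lemma sum_noncommuting_involutions :
  (\sum_(x in G) F x = #|I| * (#|I| - #|(A 2)^#|))%N.
Proof.
transitivity (\sum_(t in I) #|I :\: 'C[t]|)%N; last first.
  rewrite -sum_nat_const; apply: eq_bigr => t It.
  by rewrite -(card_commuting_involutions It) cardsD.
transitivity (\sum_(x in G) \sum_(t in I) (((t * x)%g \in I) && ((t * x)%g \notin 'C[t])))%N.
  apply: eq_bigr => x _; rewrite -sum1_card big_mkcond [RHS]big_mkcond /=.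
  by apply: eq_bigr => t _; rewrite in_set; case: (t \in I) => //=; case: (_ && _).
rewrite exchange_big /=; apply: eq_bigr => t It.
rewrite -sum1_card [RHS]big_mkcond /= [RHS](reindex_inj (mulgI t)) /= big_mkcond /=.
apply: eq_bigr => x _; rewrite in_setD andbC; case: ifP => [Gx | nGx].
  by case: (_ && _).
by case: ifP => // /andP[_ /(subsetP sIG)]; rewrite groupMl ?nGx // (subsetP sIG).
Qed.

Lemma noncommuting_involutions_class g x : g \in G -> F (x ^ g) = F x.
Proof.
move=> Gg; rewrite -[RHS](card_imset _ (conjg_inj g)); apply: eq_card => t.
rewrite -[t](conjgKV g) (mem_imset _ _ (conjg_inj g)) [LHS]in_set [RHS]in_set.
rewrite -conjMg (class_support_memJ _ (t ^ g^-1) Gg) (class_support_memJ _ (_ * x) Gg).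
by rewrite cent1J memJ_conjg.
Qed.

(** If [t] and [t * x] are involutions, [t] inverts [x] and so normalises [A p]. Noncommutation
    keeps [t] outside [A p], so the Frobenius complement has order 2. In that case every one of the
    [p] elements of ['N_G(A p) :\: A p] occurs as [t]. *)
Lemma noncommuting_involutions_aSylow p x :
    p \in primes #|G| -> x \in (A p)^# ->
  F x = if #|'N_G(A p)| == (2 * #|A p|)%N then p else 0%N.
Proof.
move=> piGp Ax; have sylA := aSylowP G p; have ntA := aSylow_neq1 piGp.
have [y [[p_pr q_pr neqpq frobN] [abA CA _]]] :=
  Sylow_local_structure simG nsolG nil2 sylA ntA.
have [defN _ _ _ _] := Frobenius_context frobN.
have [nsAN sYN defNm nAy tiAy] := sdprod_context defN.
have /normedTI_memJ_P[_ _ tiA] := Sylow_normedTI simG nsolG nil2 sylA ntA.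
have [ntx Axx] := setD1P Ax; have Gx := subsetP (pHall_sub sylA) x Axx.
have notC t : t \in G -> t \notin A p -> t \notin 'C[x].
  by move=> Gt; apply: contra => cxt; rewrite -(CA x Ax) inE Gt.
have invert t : t \in I -> t * x \in I -> t \in 'N_G(A p) /\ t * x * t = x^-1.
  move=> It Itx; have Gt := subsetP sIG t It.
  have t2 : t * t = 1 := aSylow2_involution It.
  have tV : t^-1 = t by apply/eqP; rewrite eq_invg_mul t2.
  have xt : t * x * t = x^-1.
    apply/eqP; rewrite eq_sym eq_invg_mul.
    have -> : x * (t * x * t) = t * (t * x * (t * x)) * t by rewrite !mulgA t2 mul1g.
    by rewrite [t * x * (t * x)](aSylow2_involution Itx) mulg1 t2.
  have xJt : x ^ t = x^-1 by rewrite conjgE tV mulgA xt.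
  by split=> //; rewrite -(tiA x) // xJt in_setD1 invg_eq1 ntx groupV.
case: eqP => [oN | noN].
  have [p_odd oA inv2] := inverted_Sylow sylA ntA oN.
  suff -> : [set t in I | (t * x \in I) && (t * x \notin 'C[t])] = 'N_G(A p) :\: A p.
    by rewrite cardsD (setIidPr (normal_sub nsAN)) oN oA mul2n -addnn addnK.
  apply/setP=> t; rewrite in_set in_setD; apply/and3P/andP=> [[It Itx nct] | [nAt Nt]].
    have [Nt _] := invert t It Itx; split=> //.
    apply: contra nct => At; apply/cent1P.
    by rewrite /commute -mulgA (centsP abA x Axx t At).
  have Gt : t \in G by case/setIP: Nt.
  have NAt : t \in 'N_G(A p) :\: A p by rewrite in_setD nAt.
  have nAtx : t * x \in 'N_G(A p) :\: A p.
    by rewrite in_setD groupMr // nAt groupM // (subsetP (normal_sub nsAN)).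
  have inI u : u \in 'N_G(A p) :\: A p -> u \in I.
    move=> NAu; have [/setIP[Gu _] nAu] := setDP NAu.
    apply: involution_aSylow2 => //; last by have [] := inv2 x u Axx NAu.
    by apply: contraNneq nAu => ->; apply: group1.
  split; rewrite ?inI //; apply: contra (notC t Gt nAt) => /cent1P.
  rewrite /commute -!mulgA => /mulgI ctx; exact/cent1P.
apply/eqP; rewrite cards_eq0; apply/eqP/setP=> t; rewrite [RHS]in_set0 in_set.
apply/negP => /and3P[It Itx nct]; have [Nt xt] := invert t It Itx.
have nAt : t \notin A p.
  apply: contra nct => At; apply/cent1P.
  by rewrite /commute -mulgA (centsP abA x Axx t At).
have [t2elt ntt] := aSylow_elt It.
have ot : 2 %| #[t] by have [] := pgroup_pdiv t2elt; rewrite ?cycle_eq1.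
have neqp2 : p != 2.
  have sylAN : p.-Sylow('N_G(A p)) (A p).
    by rewrite (pHall_subl _ _ sylA) ?subsetIl ?normal_sub.
  by apply: contraNneq nAt => ep; rewrite (mem_normal_Hall sylAN nsAN) // ep.
case: noN; rewrite -(sdprod_card defN) mulnC; congr (_ * _)%N.
have : 2 %| #|A p| * #|<[y]>| by rewrite (sdprod_card defN) (dvdn_trans ot) ?order_dvdG.
rewrite Euclid_dvdM // => /orP[/(pgroupP (pHall_pgroup sylA))|].
  by move=> /(_ isT); rewrite inE eq_sym (negPf neqp2).
by rewrite -orderE dvdn_prime2 // => /eqP.
Qed.

Lemma even_order_60 : #|G| = 60.
Proof.
have [y [[_ q_pr neq2q frobN] _]] :=
  Sylow_local_structure simG nsolG nil2 sylA2 ntA2.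
have [defN _ _ _ _] := Frobenius_context frobN.
set m := #|A 2|; set K := #|G : 'N_G(A 2)|; set q := #[y] in q_pr neq2q *.
have oG : #|G| = (m * q * K)%N.
  by rewrite -(Lagrange (subsetIl G 'N(A 2))) -(sdprod_card defN).
have K_gt1 : 1 < K.
  rewrite indexg_gt1 proper_subn // simple_local_proper ?(pHall_sub sylA2) //.
  exact: pgroup_sol (pHall_pgroup sylA2).
have oI : #|I| = (m.-1 * K)%N.
  rewrite (card_support_normedTI (Sylow_normedTI simG nsolG nil2 sylA2 ntA2)).
  by rewrite [#|(A 2)^#|]cardsD1_pred.
have mulrnE (x k : nat) : (x *+ k)%R = (x * k)%N.
  by elim: k => [|k IHk]; rewrite ?muln0 // GRing.mulrS IHk mulnS.
pose T p := #|'N_G(A p)| == (2 * #|A p|)%N.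
pose s := [seq p <- primes #|G| | T p].
(* A prime of [s] contributes [p * p.-1 * #|G : 'N_G(A p)|], which is half of [p.-1 * #|G|]; hence
   the factor 2. *)
have sum_s : (2 * (#|I| * (#|I| - m.-1)) = (\sum_(p <- s) p.-1) * #|G|)%N.
  have := sum_noncommuting_involutions.
  rewrite (sum_over_Sylows simG nsolG nil2 (F := fun x => F x)); last first.
    by move=> g Gg x; apply: noncommuting_involutions_class.
  have -> : F 1%g = 0%N.
    apply/eqP; rewrite cards_eq0; apply/eqP/setP=> t; rewrite [RHS]in_set0 in_set mulg1.
    by rewrite cent1id !andbF.
  rewrite GRing.add0r => /esym eS.
  have oA2 : #|(A 2)^#| = m.-1 := cardsD1_pred _.
  rewrite -oA2 eS big_distrl big_distrr /=.
  rewrite big_filter [RHS]big_mkcond [LHS]big_seq [RHS]big_seq.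
  apply: eq_bigr => p piGp; rewrite mulrnE.
  rewrite (eq_bigr (fun _ => if T p then p else 0%N)); last first.
    by move=> x Ax; apply: noncommuting_involutions_aSylow.
  rewrite sum_nat_const; case: ifP => [/eqP oN | _]; last by rewrite muln0 mul0n muln0.
  have [_ oA _] := inverted_Sylow (aSylowP G p) (aSylow_neq1 piGp) oN.
  by rewrite -(Lagrange (subsetIl G 'N(A p))) oN cardsD1_pred oA; ring.
rewrite oG; apply: (@involution_count_arith m q K (logn 2 #|G|) s).
- by rewrite /m (card_Hall sylA2) p_part.
- by rewrite logn_gt0.
- exact: q_pr.
- by case: (even_prime q_pr) => // eq2; rewrite eq2 in neq2q.
- by rewrite /q orderE; apply: Frobenius_dvd_ker1 frobN.
- exact: K_gt1.
- exact: filter_uniq (primes_uniq _).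
- move=> p; rewrite mem_filter => /andP[/eqP oN piGp].
  have [p_odd _ _] := inverted_Sylow (aSylowP G p) (aSylow_neq1 piGp) oN.
  move: piGp; rewrite mem_primes p_odd => /and3P[p_pr _]; rewrite p_pr oG /= -mulnA.
  rewrite Gauss_dvdr // /m (card_Hall sylA2) p_part coprimeXr //.
  by rewrite coprime_sym coprime2n.
apply/eqP; rewrite -(eqn_pmul2l (ltnW K_gt1)); apply/eqP; move: sum_s; rewrite oI oG.
have -> : (m.-1 * K - m.-1 = m.-1 * K.-1)%N by rewrite -{2}[m.-1]muln1 -mulnBr subn1.
move=> sum_s.
by transitivity (2 * (m.-1 * K * (m.-1 * K.-1)))%N; [ring | rewrite sum_s; ring].
Qed.

End EvenOrder.

(** * Odd order *)

Section Characters.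

Import Order.TTheory GRing.Theory Num.Theory.
Local Open Scope ring_scope.

(** * Integer functions with large level sets *)

Section SquaredDifferences.

Variables (I : finType) (i0 : I) (f : I -> int) (l : nat).

Local Notation D i j := ((f i - f j) ^+ 2).

Lemma sum_squared_differences :
  \sum_i \sum_j D i j = 2 * (#|I|%:R * (\sum_i f i ^+ 2) - (\sum_i f i) ^+ 2).
Proof.
transitivity (\sum_i (#|I|%:R * f i ^+ 2 + \sum_j f j ^+ 2 - 2 * f i * (\sum_j f j))).
  apply: eq_bigr => i _.
  rewrite mulr_natl -sumr_const mulr_sumr -big_split /= -sumrB.
  by apply: eq_bigr => j _; ring.
rewrite sumrB big_split /= sumr_const -mulr_sumr -mulr_natl -mulr_suml -mulr_sumr.
by ring.
Qed.

Lemma sum_differences_split :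
  \sum_i \sum_j D i j =
    \sum_(i | i != i0) \sum_(j | j != i0) D i j + 2 * \sum_(j | j != i0) D i0 j.
Proof.
rewrite (bigD1 i0) //= (bigD1 i0) //= subrr expr0n add0r addrC.
rewrite (eq_bigr (fun i => D i0 i + \sum_(j | j != i0) D i j)).
  by rewrite big_split /=; ring.
by move=> i _; rewrite (bigD1 i0) //=; congr (_ + _); ring.
Qed.

Lemma card_differences_le i (P B : pred I) :
    (forall j, P j -> B j -> f j != f i) ->
  #|[set j | P j && B j]|%:Z <= \sum_(j | P j) D i j.
Proof.
move=> PBne; rewrite -sum1_card (eq_bigl (fun j => P j && B j)) => [|j]; last by rewrite inE.
rewrite big_mkcondr /= (big_morph Posz PoszD (erefl 0%:Z)); apply: ler_sum => j Pj.
case: ifP => [Bj|_]; last exact: sqr_ge0.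
have: f i - f j != 0 by rewrite subr_eq0 eq_sym PBne.
by rewrite -sqrf_eq0; have := sqr_ge0 (f i - f j); lia.
Qed.

Hypothesis level_ge : forall i, i != i0 -> (l <= #|[set j | (j != i0) && (f j == f i)]|)%N.

(** Let [U] be the level set of [f i1] and [V] its complement, both off [i0]. Each has at least [l]
    elements, and [2 * #|U| * #|V|] is least when one has exactly [l]. Moreover [f i0] differs from
    [f] on all of [U] or on all of [V]. *)
Lemma nonconstant_differences i1 i2 :
    i1 != i0 -> i2 != i0 -> f i1 != f i2 ->
  2 * l%:Z * (#|I|%:Z - 1 - l%:Z) <= \sum_(i | i != i0) \sum_(j | j != i0) D i j
  /\ l%:Z <= \sum_(j | j != i0) D i0 j.
Proof.
move=> nti1 nti2 ne12; set U := [set j | (j != i0) && (f j == f i1)].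
pose V := [set j | (j != i0) && (f j != f i1)].
have cardUV : (#|U| + #|V|).+1 = #|I|.
  have -> : (#|U| + #|V|)%N = #|[set~ i0]|.
    have -> : [set~ i0] = U :|: V.
      by apply/setP=> j; rewrite !inE -andb_orr orbN andbT.
    rewrite cardsU (_ : U :&: V = set0) ?cards0 ?subn0 //.
    by apply/setP=> j; rewrite !inE; case: eqP => //=; case: eqP.
  by rewrite cardsC1 prednK //; apply/card_gt0P; exists i0.
have leU : (l <= #|U|)%N by apply: level_ge.
have leV : (l <= #|V|)%N.
  apply: leq_trans (level_ge nti2) (subset_leq_card _).
  by apply/subsetP=> j; rewrite !inE => /andP[-> /eqP->]; rewrite eq_sym.
split.
  have -> : \sum_(i | i != i0) \sum_(j | j != i0) D i j =
      \sum_(i in U) \sum_(j | j != i0) D i j + \sum_(i in V) \sum_(j | j != i0) D i j.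
    rewrite (bigID (fun i => f i == f i1)) /=.
    by congr (_ + _); apply: eq_bigl => i; rewrite inE.
  have leUV : \sum_(i in U) #|V|%:Z <= \sum_(i in U) \sum_(j | j != i0) D i j.
    apply: ler_sum => i; rewrite inE => /andP[_ /eqP eqi].
    by apply: card_differences_le => j _; rewrite eqi.
  have leVU : \sum_(i in V) #|U|%:Z <= \sum_(i in V) \sum_(j | j != i0) D i j.
    apply: ler_sum => i; rewrite inE => /andP[_ nei].
    by apply: card_differences_le => j _ /eqP->; rewrite eq_sym.
  apply: le_trans (lerD leUV leVU); rewrite !sumr_const -cardUV.
  move: leU leV; rewrite -(mulr_natr #|V|%:Z) -(mulr_natr #|U|%:Z) !natz; clear.
  move: #|U| #|V| => u v; nia.
have [e01 | ne01] := eqVneq (f i0) (f i1).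
  apply: le_trans (_ : #|V|%:Z <= _); first by rewrite lez_nat.
  by apply: card_differences_le => j _; rewrite e01.
apply: le_trans (_ : #|U|%:Z <= _); first by rewrite lez_nat.
by apply: card_differences_le => j _ /eqP->; rewrite eq_sym.
Qed.

End SquaredDifferences.


(* With [A] the smallest Sylow subgroup: [a = #|A|], [l = #|N(A) : A|],
   [g = #|G : N(A)|], [n = #|G|], and [d] is the squared degree of an
   exceptional character [k0]. [SB] and [SC] count the nontrivial elements of
   the other Sylow subgroups, where [k0] does not or does vanish; [E] and [SE]
   count the characters exceptional for [A] and for the subgroups of [SC]. *)
Lemma odd_count_absurd (a l g w E n d SB SC SE : int) :
    2 <= w -> 1 <= l -> 1 <= g -> a = w * l + 1 -> n = g * a * l -> 1 < d ->
    d + g * (l * (a - l)) + SB <= n ->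
    (a - 1) + E * (l * (a - l)) + SE * (a - 1) <= (a - 1) * a -> a - 1 <= l * E ->
    n = 1 + g * (a - 1) + SB + SC -> SC <= g * l * SE -> False.
Proof.
move=> w2 l1 g1 ea en d1 row col leE cls leSC.
have l0 : 0 < l by lia.
have wl0 : 0 < w * l by rewrite mulr_gt0 //; lia.
have leSE : SE <= l - 1.
  have : w <= E by rewrite -(ler_pM2l l0); move: leE; rewrite ea; lia.
  rewrite -(ler_pM2r (_ : 0 < l * (a - l))); last first.
    rewrite mulr_gt0 // ea; have : l <= w * l by rewrite ler_peMl; lia.
    lia.
  move=> leEw; rewrite -(ler_pM2r wl0).
  have -> : (l - 1) * (w * l) = w * l * a - w * l - w * (l * (a - l)) by ring.
  have eal : w * l = a - 1 by rewrite ea addrK.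
  rewrite eal; move: col leEw; clear; lia.
(* With [SE <= l - 1], comparing the row bound with the class equation leaves
   [d + g * l * (w - 2) * (l - 1) <= 1], against [1 < d]. *)
have : g * l * SE <= g * l * (l - 1) by rewrite ler_pM2l ?mulr_gt0 //; lia.
have : 0 <= g * l * ((w - 2) * (l - 1)).
  by rewrite !mulr_ge0 //; lia.
have -> : g * l * ((w - 2) * (l - 1)) =
    g * (l * (a - l)) - g * (a - 1) - g * l * (l - 1) by rewrite ea; ring.
lia.
Qed.

Lemma card_pred_intr (gT : finGroupType) (H : {group gT}) :
  #|H|.-1%:R = (#|H|%:Z - 1)%:~R :> algC.
Proof. by rewrite pmulrn -subn1 -subzn. Qed.

(** * Multiplicities of the linear characters of an abelian Frobenius kernel *)

Section FrobeniusTI.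

Variables (gT : finGroupType) (G N A : {group gT}).
Hypotheses (TIA : normedTI A^# G N) (frobN : [Frobenius N with kernel A]).
Hypothesis abA : abelian A.

Local Notation a := #|A|.
Local Notation l := #|N : A|.

Let nsAN : A <| N. Proof. by have [] := Frobenius_kerP frobN. Qed.
Let sAN : A \subset N := normal_sub nsAN.
Let sNG : N \subset G. Proof. by have /normedTI_memJ_P[] := TIA. Qed.
Let sAG : A \subset G := subset_trans sAN sNG.

Definition mult (k : Iirr G) (i : Iirr A) : int :=
  (Num.truncn '['Res[A] 'chi_k, 'chi_i])%:Z.

Lemma multE k i : '['Res[A] 'chi_k, 'chi_i] = (mult k i)%:~R.
Proof. by rewrite -pmulrn truncnK // Cnat_cfdot_char ?cfRes_char ?irr_char. Qed.

Lemma mult_Ind k i : '['chi_k, 'Ind[G] 'chi[A]_i] = (mult k i)%:~R.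
Proof. by rewrite -multE cfdot_Res_l. Qed.

Let lin_A i : 'chi[A]_i 1%g = 1.
Proof. by rewrite lin_char1 //; apply/char_abelianP. Qed.

Lemma card_Iirr_A : #|Iirr A| = a.
Proof. by rewrite card_ord NirrE; apply/eqP; rewrite -card_classes_abelian. Qed.

Lemma irr_deg_sum k : 'chi_k 1%g = (\sum_i mult k i)%:~R.
Proof.
rewrite -(cfRes1 A) [in LHS](cfun_sum_cfdot ('Res[A] 'chi_k)) sum_cfunE rmorph_sum /=.
by apply: eq_bigr => i _; rewrite cfunE lin_A mulr1 multE.
Qed.

Lemma Res_norm_sum k :
  \sum_(x in A) `|'chi[G]_k x| ^+ 2 = (a%:R * \sum_i mult k i ^+ 2)%:~R.
Proof.
have : '['Res[A] 'chi_k] = (\sum_i mult k i ^+ 2)%:~R.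
  rewrite cfdot_sum_irr rmorph_sum /=; apply: eq_bigr => i _.
  by rewrite multE conj_intr ?intr_int // rmorphXn expr2.
rewrite (cfnormE (cfun_onG _)) rmorphM /= => <-.
rewrite rmorph_nat mulVKf ?neq0CG //; apply: eq_bigr => x Ax.
by rewrite cfResE.
Qed.

(** By Parseval on [A], this is the sum of [|chi_k| ^ 2] over [A^#]; the subtracted square is the
    value at 1. *)
Definition normA (k : Iirr G) : int := a%:R * (\sum_i mult k i ^+ 2) - (\sum_i mult k i) ^+ 2.

Lemma normAE k : \sum_(x in A^#) `|'chi[G]_k x| ^+ 2 = (normA k)%:~R.
Proof.
rewrite /normA rmorphB /= -Res_norm_sum rmorphXn /= -irr_deg_sum.
rewrite [in RHS](big_setD1 1%g) //= irr1_degree normr_nat; ring.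
Qed.

(** The restriction is [c] times the regular character, which vanishes off 1, plus [mult k 0 - c]
    times the principal one. *)
Lemma mult_const k c x :
  (forall i, i != 0 -> mult k i = c) -> x \in A^# -> 'chi_k x = (mult k 0 - c)%:~R.
Proof.
move=> mc /setD1P[ntx Ax].
have : \sum_(i : Iirr A) 'chi_i x = 0.
  transitivity (cfReg A x); last by rewrite cfRegE (negPf ntx).
  rewrite cfReg_sum sum_cfunE.
  by apply: eq_bigr => i _; rewrite cfunE lin_A mul1r.
rewrite (bigD1 0) //= irr0 cfun1E Ax => sum0.
rewrite -(cfResE _ sAG Ax) [in LHS](cfun_sum_cfdot ('Res[A] 'chi_k)) sum_cfunE.
rewrite (bigD1 0) //= cfunE irr0 cfun1E Ax mulr1 -irr0 multE.
rewrite (eq_bigr (fun i => c%:~R * 'chi_i x)).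
  rewrite -mulr_sumr rmorphB /=; congr (_ + _).
  have -> : \sum_(i < Nirr A | i != 0) 'chi_i x = -1.
    by apply/eqP; rewrite -addr_eq0 addrC sum0.
  by rewrite mulrN1.
by move=> i nti; rewrite cfunE multE mc.
Qed.

Lemma Res_Ind_TI (theta : 'CF(A)) :
  theta 1%g = 0 -> 'Res[A] ('Ind[G] theta) = 'Res[A] ('Ind[N] theta).
Proof.
move=> th1; apply/cfun_inP=> x Ax; rewrite !cfResE //.
have [-> | ntx] := eqVneq x 1%g; first by rewrite !cfInd1 ?th1 ?mulr0.
rewrite !cfIndE //; congr (_ * _); rewrite (big_setID N) /= (setIidPr sNG).
rewrite [X in _ + X]big1 ?addr0 // => y /setDP[Gy nNy]; apply: cfun0.
have /normedTI_memJ_P[_ _ tiA] := TIA.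
have Axx : x \in A^# by rewrite !inE ntx.
by move: nNy; rewrite -(tiA x) // !inE conjg_eq1 ntx.
Qed.

Local Notation indN i := ('Ind[N] 'chi[A]_i).

(** By Parseval the sum is the norm of the character induced to [G] from ['chi_i - 'chi_j]. By
    trivial intersection it equals the norm of [indN i - indN j], a difference of two irreducible
    characters. *)
Lemma mult_differences i j : i != 0 -> j != 0 ->
  \sum_k (mult k i - mult k j) ^+ 2 = (if indN i == indN j then 0 else 2).
Proof.
move=> nti ntj; pose theta : 'CF(A) := 'chi_i - 'chi_j.
have th1 : theta 1%g = 0 by rewrite !cfunE !lin_A subrr.
apply/eqP; rewrite -(eqr_int algC) rmorph_sum /=; apply/eqP.
transitivity '['Ind[G] theta].
  rewrite cfdot_sum_irr; apply: eq_bigr => k _.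
  have -> : '['Ind[G] theta, 'chi_k] = (mult k i - mult k j)%:~R.
    rewrite rmorphB /= -!mult_Ind /theta linearB cfdotBl /=.
    by congr (_ - _); rewrite cfdotC_char ?cfInd_char ?irr_char.
  by rewrite conj_intr ?intr_int // -rmorphM expr2.
rewrite -Frobenius_reciprocity Res_Ind_TI // Frobenius_reciprocity /theta linearB /=.
have [ei ej] : indN i \in irr N /\ indN j \in irr N by split; apply: irr_induced_Frobenius_ker.
case: eqP => [-> | ne]; first by rewrite subrr cfdot0l.
have /irrP[i' ei'] := ei; have /irrP[j' ej'] := ej.
rewrite ei' ej' in ne *; rewrite cfnormB !cfnorm_irr cfdot_irr.
have -> : i' == j' = false by apply/eqP=> e; rewrite e in ne.
by rewrite conjC0 addr0 subr0.
Qed.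

Lemma mult_vanish i j y : i != 0 -> j != 0 -> y \notin class_support A^# G ->
  \sum_k (mult k i - mult k j)%:~R * 'chi[G]_k y = 0.
Proof.
move=> nti ntj nAy; pose theta : 'CF(A) := 'chi_i - 'chi_j.
have thA : theta \in 'CF(A, A^#).
  apply/cfun_onP=> x; rewrite !inE negb_and negbK => /orP[/eqP->|nAx].
    by rewrite !cfunE !lin_A subrr.
  exact: cfun0.
transitivity ('Ind[G] theta y); last exact: cfun_on0 (cfInd_on sAG thA) nAy.
rewrite [in RHS](cfun_sum_cfdot ('Ind[G] theta)).
rewrite sum_cfunE; apply: eq_bigr => k _; rewrite cfunE; congr (_ * _).
rewrite rmorphB /= -!mult_Ind /theta linearB cfdotBl /=.
by congr (_ - _); rewrite cfdotC_char ?cfInd_char ?irr_char.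
Qed.

Lemma mult_Ind_eq k i j : indN i = indN j -> mult k i = mult k j.
Proof.
move=> e; apply/eqP; rewrite -(eqr_int algC) -!mult_Ind.
by rewrite -!(cfIndInd _ sNG sAN) e.
Qed.

(** By reciprocity the restriction of [indN i] to [A] is the sum of the linear characters inducing
    it, each taken once; its degree [l] counts them. *)
Lemma card_Ind_class i : i != 0 -> #|[set j | (j != 0) && (indN j == indN i)]| = l.
Proof.
move=> nti; apply/eqP; rewrite -(eqr_nat algC); apply/eqP.
have ei : indN i \in irr N by apply: irr_induced_Frobenius_ker.
have /irrP[i' ei'] := ei.
transitivity ('Res[A] (indN i) 1%g); last by rewrite cfRes1 cfInd1 // lin_A mulr1.
rewrite [in RHS](cfun_sum_cfdot ('Res[A] (indN i))) sum_cfunE.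
rewrite -sum1_card natr_sum big_mkcond /=; apply: eq_bigr => j _.
rewrite cfunE lin_A mulr1 cfdot_Res_l inE ei'.
have [-> | ntj] := eqVneq j 0.
  rewrite irr0 cfInd_cfun1 // cfdotZr -ei' -Frobenius_reciprocity.
  suff -> : 'Res[A] ('1_A : 'CF(N)) = 'chi_0 by rewrite cfdot_irr (negPf nti) mulr0.
  apply/cfun_inP=> x Ax; rewrite cfResE // cfuniE // Ax irr0 cfun1E Ax //.
have /irrP[j' ej'] : indN j \in irr N by apply: irr_induced_Frobenius_ker.
by rewrite ej' cfdot_irr (inj_eq irr_inj) eq_sym; case: (_ == _).
Qed.

Definition exceptional (k : Iirr G) : bool :=
  [exists i, exists j, [&& i != 0, j != 0 & mult k i != mult k j]].

Lemma exceptionalPn k : ~~ exceptional k -> exists c, forall i, i != 0 -> mult k i = c.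
Proof.
rewrite negb_exists => /forallP nek; case: (pickP (fun i : Iirr A => i != 0)) => [i0 nti0 | no].
  exists (mult k i0) => i nti; apply/eqP; have := nek i; rewrite negb_exists.
  by move/forallP/(_ i0); rewrite nti nti0 /= negbK.
by exists 0 => i nti; have := no i; rewrite nti.
Qed.

Lemma irr0_nonexceptional : ~~ exceptional 0.
Proof.
apply/negP=> /existsP[i /existsP[j /and3P[nti ntj /negP[]]]].
rewrite -(eqr_int algC) -!multE irr0 rmorph1 -irr0 !cfdot_irr.
by rewrite ![0 == _]eq_sym (negPf nti) (negPf ntj).
Qed.

Lemma nonexceptional_value k : ~~ exceptional k ->
  exists z : int, forall x, x \in A^# -> 'chi_k x = z%:~R.
Proof.
move=> /exceptionalPn[c mc]; exists (mult k 0 - c) => x Ax.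
exact: mult_const mc Ax.
Qed.

Lemma normA_ge0 k : 0 <= normA k.
Proof.
by rewrite -(ler_int algC) -normAE sumr_ge0 // => x _; apply: exprn_ge0.
Qed.

Local Notation differences k :=
  (\sum_(i | i != 0) \sum_(j | j != 0) (mult k i - mult k j) ^+ 2).

Lemma nonexceptional_differences k : ~~ exceptional k -> differences k = 0.
Proof.
move=> /exceptionalPn[c mc]; rewrite big1 // => i nti; rewrite big1 // => j ntj.
by rewrite !mc // subrr expr0n.
Qed.

Lemma normA_differences k :
  2 * normA k = differences k + 2 * \sum_(j | j != 0) (mult k 0 - mult k j) ^+ 2.
Proof. by rewrite -sum_differences_split sum_squared_differences card_Iirr_A. Qed.

Lemma exceptional_differences k : exceptional k ->
  2 * l%:Z * (a%:Z - 1 - l%:Z) <= differences k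
  /\ l%:Z <= \sum_(j | j != 0) (mult k 0 - mult k j) ^+ 2.
Proof.
case/existsP=> i /existsP[j /and3P[nti ntj neij]].
rewrite -card_Iirr_A; apply: nonconstant_differences nti ntj neij => r ntr.
rewrite -(card_Ind_class ntr); apply/subset_leq_card/subsetP=> s; rewrite !inE.
by case/andP=> -> /eqP e; rewrite (mult_Ind_eq _ e) eqxx.
Qed.

(** Since [2 * l < a] in the application, this exceeds half of [a * l], so the conjugates of [A]
    carry more than half of the norm of the character. *)
Lemma exceptional_normA k : exceptional k -> l%:Z * (a%:Z - l%:Z) <= normA k.
Proof.
move=> /exceptional_differences[]; have := normA_differences k.
set X := differences k; set Y := \sum_(j | _) _; move: (normA k) => Z.
move: (l) (a) X Y; clear => l a X Y; lia.
Qed.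

Lemma sum_neq0_const (x : int) : \sum_(i : Iirr A | i != 0) x = (a%:Z - 1) * x.
Proof.
rewrite sumr_const (_ : #|_| = a.-1); last by rewrite -card_Iirr_A; apply: cardC1.
have : (0 < a)%N by apply: cardG_gt0.
by case: (a) => // n _; rewrite -mulr_natl natz /=; congr (_ * _); lia.
Qed.

Lemma normA_value k (z : int) :
  (forall x, x \in A^# -> 'chi_k x = z%:~R) -> normA k = (a%:Z - 1) * z ^+ 2.
Proof.
move=> chiz; apply/eqP; rewrite -(eqr_int algC) -normAE.
rewrite (eq_bigr (fun _ => (z ^+ 2)%:~R)) => [|x Ax]; last first.
  by rewrite chiz // -intr_norm -rmorphXn /= real_normK ?num_real.
apply/eqP; rewrite sumr_const cardsD1_pred -[LHS]mulr_natl [RHS]rmorphM /=.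
congr (_ * _); exact: card_pred_intr.
Qed.

Lemma index_normedTI : #|G| = (#|G : N| * (a * l))%N.
Proof. by rewrite (Lagrange sAN) mulnC (Lagrange sNG). Qed.

Lemma sum_differences :
  \sum_k differences k = 2 * (a%:Z - 1) * (a%:Z - 1 - l%:Z).
Proof.
rewrite exchange_big /= (eq_bigr (fun _ => 2 * (a%:Z - 1 - l%:Z))) => [|i nti].
  by rewrite sum_neq0_const; ring.
rewrite exchange_big /=.
rewrite (eq_bigr (fun j => 2 - (if indN j == indN i then 2 else 0))) => [|j ntj]; last first.
  by rewrite mult_differences // eq_sym; case: eqP.
rewrite sumrB sum_neq0_const.
have -> : \sum_(j | j != 0) (if indN j == indN i then 2 else 0) = 2 * l%:Z.
  rewrite -big_mkcondr sumr_const -[LHS]mulr_natr (natz #|_|); congr (_ * Posz _).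
  by rewrite -(card_Ind_class nti); apply: eq_card => j; rewrite !inE.
by ring.
Qed.

Lemma normA_lt k : normA k < a%:Z * l%:Z.
Proof.
have sum1 : \sum_(x in G) `|'chi_k x| ^+ 2 = #|G|%:R.
  have := cfnorm_irr k; rewrite (cfnormE (cfun_onG _)) => /(canRL (mulVKf (neq0CG G)))->.
  by rewrite mulr1.
have sub : class_support A^# G \subset G^#.
  apply/subsetP=> _ /imset2P[x g /setD1P[ntx Ax] Gg ->].
  by rewrite !inE conjg_eq1 ntx /= groupJ //; apply: (subsetP sAG).
have FJ : {in G, forall g x, `|'chi_k (x ^ g)%g| ^+ 2 = `|'chi_k x| ^+ 2}.
  by move=> g Gg x /=; rewrite cfunJ.
have := sum_class_support TIA FJ; rewrite normAE => eS.
rewrite -(ltr_int algC) -(ltr_pM2r (_ : 0 < #|G : N|%:R)) ?ltr0n ?indexg_gt0 //.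
rewrite mulr_natr -eS !rmorphM /= -!natrM mulnC -index_normedTI -sum1.
rewrite [X in _ < X](big_setD1 1%g) //= [X in _ < _ + X](big_setID (class_support A^# G)) /=.
rewrite (setIidPr sub) addrCA ltrDl ltr_pwDl ?sumr_ge0 // => [|x _]; last exact: exprn_ge0.
by rewrite exprn_gt0 // normr_gt0 irr1_neq0.
Qed.

Hypothesis l_small : (2 * l < a)%N.

(** The total of [sum_differences] is compared with an upper bound for each character. With
    [a - 1 = w * l], fewer than [w] exceptional characters cannot make up the total. *)
Lemma card_exceptional : a%:Z - 1 <= l%:Z * #|[set k | exceptional k]|%:Z.
Proof.
(* The final [- 1] comes from the strictness of [normA_lt]; without it [w - 1] exceptional
   characters would not be excluded. *)
have leT k : differences k <= (if exceptional k then 2 * l%:Z * (a%:Z - 1) - 1 else 0).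
  case: ifP => [Ek | /negbT nEk]; last by rewrite nonexceptional_differences.
  have [_] := exceptional_differences Ek; have := normA_differences k; have := normA_lt k.
  set X := differences k; set Y := \sum_(j | _) _; move: (normA k) => Z.
  move: (l) (a) X Y; clear => l a X Y; lia.
have := ler_sum (index_enum _) (fun k (_ : true) => leT k).
rewrite sum_differences; set c := _ - 1 in leT *.
have -> : \sum_k (if exceptional k then c else 0) = c * #|[set k | exceptional k]|%:Z.
  rewrite -big_mkcond sumr_const -[LHS]mulr_natr (natz #|_|); congr (_ * Posz _).
  by apply: eq_card => k; rewrite !inE.
rewrite /c {leT c}; move: l_small; set E := #|[set k | exceptional k]|.
have : (0 < l)%N by apply: indexg_gt0.
have /dvdnP[w ew] := Frobenius_ker_dvd_ker1 frobN.
have -> : a = (w * l).+1 by rewrite -ew prednK.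
move: (l) E {ew}; clear => l E l0 lw.
have {lw} w2 : (1 < w)%N by case: w lw => [|[|w]] //; lia.
have -> : (w * l).+1%:Z - 1 = w%:Z * l%:Z by rewrite intS [1 + _]addrC addrK PoszM.
move=> le1; rewrite mulrC ler_pM2l ?ltz_nat //.
rewrite lez_nat leqNgt; apply/negP=> ltE.
have {}ltE : 0 <= w%:Z - 1 - E%:Z by lia.
have := mulr_ge0 (mulr_ge0 (ler0n int w) (sqr_ge0 l%:Z)) ltE; rewrite !natz => le2.
have eE : E%:Z = 0 by nia.
rewrite eE in le1 le2; nia.
Qed.

(** [Z i j] and [V i j] say that no character vanishing, respectively not vanishing, at [y]
    separates [i] from [j]. These are equivalence relations and every nontrivial pair satisfies one
    of them, so one of them is total. The vanishing [k1] shows that it is not [Z], so a nonvanishing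
    character is not exceptional. *)
Lemma exceptional_vanishing y k1 k2 : y \notin class_support A^# G ->
  exceptional k1 -> exceptional k2 -> 'chi[G]_k1 y = 0 -> 'chi[G]_k2 y = 0.
Proof.
move=> nAy /existsP[i1 /existsP[j1 /and3P[nti1 ntj1 ne1]]].
case/existsP=> i2 /existsP[j2 /and3P[nti2 ntj2 ne2]] v1.
apply/eqP; apply: contraT => v2.
pose Z i j := [forall k, ('chi[G]_k y == 0) ==> (mult k i == mult k j)].
pose V i j := [forall k, ('chi[G]_k y != 0) ==> (mult k i == mult k j)].
have Zsym i j : Z i j = Z j i by apply: eq_forallb => k; rewrite [mult k i == _]eq_sym.
have Vsym i j : V i j = V j i by apply: eq_forallb => k; rewrite [mult k i == _]eq_sym.
have Ztr i j r : Z i j -> Z j r -> Z i r.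
  move=> /forallP Zij /forallP Zjr; apply/forallP=> k; apply/implyP=> vk.
  by rewrite (eqP (implyP (Zij k) vk)) (implyP (Zjr k) vk).
have Vtr i j r : V i j -> V j r -> V i r.
  move=> /forallP Vij /forallP Vjr; apply/forallP=> k; apply/implyP=> vk.
  by rewrite (eqP (implyP (Vij k) vk)) (implyP (Vjr k) vk).
(* Only two characters separate [i] from [j], and their values at [y] cancel. *)
have ZV i j : i != 0 -> j != 0 -> ~~ Z i j -> V i j.
  move=> nti ntj; rewrite negb_forall => /existsP[k].
  rewrite negb_imply => /andP[/eqP vk nek].
  apply/forallP=> r; apply/implyP; apply: contraR => ner.
  have [->|nekr] := eqVneq r k; first exact/eqP.
  have := mult_differences nti ntj; have := mult_vanish nti ntj nAy.
  rewrite (bigD1 r) //= => sumv sumD.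
  have {}sumD : \sum_k (mult k i - mult k j) ^+ 2 <= 2 by rewrite sumD; case: ifP.
  suff D0 s : s != r -> s != k -> mult s i = mult s j.
    move: sumv; rewrite big1 ?addr0 => [|s nesr]; last first.
      have [->|nesk] := eqVneq s k; first by rewrite vk mulr0.
      by rewrite D0 // subrr mul0r.
    by move/eqP; rewrite mulf_eq0 intr_eq0 subr_eq0 (negPf ner).
  move=> nesr nesk; apply/eqP; rewrite -subr_eq0 -sqrf_eq0.
  move: sumD; rewrite (bigD1 k) //= (bigD1 r) //= (bigD1 s) ?nesk //=.
  have : 0 <= \sum_(t | (t != k) && (t != r) && (t != s)) (mult t i - mult t j) ^+ 2.
    by apply: sumr_ge0 => t _; apply: sqr_ge0.
  have : (mult k i - mult k j) ^+ 2 != 0 by rewrite sqrf_eq0 subr_eq0.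
  have : (mult r i - mult r j) ^+ 2 != 0 by rewrite sqrf_eq0 subr_eq0.
  have := sqr_ge0 (mult k i - mult k j); have := sqr_ge0 (mult r i - mult r j).
  have := sqr_ge0 (mult s i - mult s j).
  set X := \sum_(_ | _) _.
  move: X (_ ^+ 2) ((mult k i - _) ^+ 2) ((mult r i - _) ^+ 2); clear; lia.
have V1 r : r != 0 -> V i1 r.
  have nZ1 : ~~ Z i1 j1.
    by rewrite negb_forall; apply/existsP; exists k1; rewrite v1 eqxx ne1.
  move=> ntr; have [Zr | nZr] := boolP (Z i1 r); last exact: ZV.
  apply: Vtr (ZV _ _ nti1 ntj1 nZ1) (ZV _ _ ntj1 ntr _).
  by apply: contra nZ1 => Zjr; apply: Ztr Zr _; rewrite Zsym.
have : V i2 j2 by apply: Vtr (V1 _ ntj2); rewrite Vsym V1.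
by move/forallP/(_ k2); rewrite v2 (negPf ne2).
Qed.

End FrobeniusTI.

(** Burnside: a real nontrivial character sums to 0 over [G] and agrees on [x] and [x^-1], so half
    its degree is a rational algebraic integer, while the degree divides the odd order. [ltV] picks
    one element from each pair of inverses. *)
Lemma odd_irr_conj_neq (gT : finGroupType) (G : {group gT}) (k : Iirr G) :
  odd #|G| -> k != 0 -> conjC_Iirr k != k.
Proof.
move=> oddG ntk; apply/eqP=> ck.
have chiV x : 'chi_k x^-1%g = 'chi_k x.
  by rewrite irr_inv -[in RHS]ck conjC_IirrE cfunE.
have sum0 : \sum_(x in G) 'chi_k x = 0.
  transitivity (\sum_(x in G) 'chi_k x * ((1 : 'CF(G)) x)^*).
    by apply: eq_bigr => x Gx; rewrite cfun1E Gx rmorph1 mulr1.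
  have := cfdot_irr k 0; rewrite (negPf ntk) irr0 cfdotE => /eqP.
  by rewrite mulf_eq0 invr_eq0 (negPf (neq0CG G)) /= => /eqP.
pose ltV (x : gT) := (enum_rank x < enum_rank x^-1%g)%N.
have sumV : \sum_(x in G^# | ~~ ltV x) 'chi_k x = \sum_(x in G^# | ltV x) 'chi_k x.
  rewrite (reindex_inj invg_inj) /=; apply: eq_big => [x | x _]; last exact: chiV.
  rewrite !inE groupV invg_eq1 /ltV invgK -leqNgt leq_eqVlt -andbA -[RHS]andbA.
  case: eqVneq => //= ntx; case Gx: (x \in G) => //=.
  case: eqP => // /ord_inj/enum_rank_inj xV; case/eqP: ntx; apply/eqP.
  have x2 : (#[x]%g %| 2)%N.
    by rewrite order_dvdn expgS expg1 {1}xV mulVg.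
  rewrite -order_eq1 -dvdn1 -(eqP (_ : coprime #[x]%g 2)) ?dvdn_gcd ?dvdnn //.
  by rewrite coprimen2 (dvdn_odd (order_dvdG Gx)).
move: sum0; rewrite (big_setD1 1%g) //= (bigID ltV) /= sumV => /eqP.
rewrite addr_eq0 -mulr2n -mulr_natl => /eqP deg.
have /natrP[n degn] := Cnat_irr1 k.
have dvn : (n %| #|G|)%N by have := dvd_irr1_cardG k; rewrite degn dvdC_nat.
have n_odd := dvdn_odd dvn oddG.
have : (n%:R / 2 : algC) \in Num.int.
  apply: Cint_rat_Aint; first by rewrite rpred_div ?rpred_nat.
  rewrite -degn deg -mulrN mulrC mulKf ?pnatr_eq0 // rpredN rpred_sum // => x _.
  exact: Aint_irr.
case/intrP=> z /(canRL (divfK (_ : 2 != 0))); rewrite pnatr_eq0 => /(_ isT)/eqP.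
rewrite -[2]/(2%:Z%:~R) -rmorphM pmulrn eqr_int => /eqP nz.
by move: n_odd nz; clear; lia.
Qed.

(** * Exceptional characters at different primes *)

Section OddOrder.

Variables (gT : finGroupType) (G : {group gT}).
Hypotheses (simG : simple G) (nsolG : ~~ solvable G) (oddG : odd #|G|).
Hypothesis nil2 : forall H K : {group gT}, H \proper G -> K \proper H -> nilpotent K.

Local Notation A := (aSylow G).
Local Notation N p := 'N_G(A p).
Local Notation s := (primes #|G|).

Let TIA p : p \in s -> normedTI (A p)^# G (N p).
Proof. by move=> sp; apply: Sylow_normedTI (aSylowP G p) (aSylow_neq1 sp). Qed.

Let abA p : p \in s -> abelian (A p).
Proof.
by move=> sp; have [y [_ []]] :=
  Sylow_local_structure simG nsolG nil2 (aSylowP G p) (aSylow_neq1 sp).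
Qed.

Let centA p x : p \in s -> x \in (A p)^# -> 'C_G[x]%g = A p.
Proof.
by move=> sp; have [y [_ [_ CA _]]] :=
  Sylow_local_structure simG nsolG nil2 (aSylowP G p) (aSylow_neq1 sp); apply: CA.
Qed.

Let frobN p : p \in s -> [Frobenius N p with kernel A p].
Proof.
move=> sp; have [y [[_ _ _ frobN] _]] :=
  Sylow_local_structure simG nsolG nil2 (aSylowP G p) (aSylow_neq1 sp).
exact: FrobeniusWker frobN.
Qed.

Let l_small p : p \in s -> (2 * #|N p : A p| < #|A p|)%N.
Proof.
move=> sp; have [y [[_ _ _ frobNy] _]] :=
  Sylow_local_structure simG nsolG nil2 (aSylowP G p) (aSylow_neq1 sp).
have oddN : odd #|N p| by apply: oddSg (subsetIl _ _) oddG.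
have := ltn_odd_Frobenius_ker frobNy oddN; rewrite -mul2n.
have [defN _ _ _ _] := Frobenius_context frobNy.
have [nsAN _ _ _ _] := sdprod_context defN.
by rewrite -divgS ?normal_sub // -(sdprod_card defN) mulKn.
Qed.

Let orderG p : p \in s -> #|G| = (#|G : N p| * (#|A p| * #|N p : A p|))%N.
Proof. by move=> sp; apply: index_normedTI (TIA sp) (frobN sp). Qed.

Lemma irr_norm_Sylows k n : 'chi[G]_k 1%g = n%:R ->
  #|G|%:Z = n%:Z ^+ 2 + \sum_(p <- s) #|G : N p|%:Z * normA (A p) k.
Proof.
move=> degn; apply/eqP; rewrite -(eqr_int algC); apply/eqP.
have sum1 : \sum_(x in G) `|'chi_k x| ^+ 2 = #|G|%:R.
  have := cfnorm_irr k; rewrite (cfnormE (cfun_onG _)) => /(canRL (mulVKf (neq0CG G)))->.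
  by rewrite mulr1.
have FJ : {in G, forall g x, `|'chi_k (x ^ g)%g| ^+ 2 = `|'chi_k x| ^+ 2}.
  by move=> g Gg x /=; rewrite cfunJ.
rewrite -pmulrn -sum1 (sum_over_Sylows simG nsolG nil2 FJ) degn normr_nat.
rewrite rmorphD rmorphXn /= -pmulrn rmorph_sum /=; congr (_ + _).
rewrite [LHS]big_seq [RHS]big_seq; apply: eq_bigr => p sp.
by rewrite (normAE (TIA sp) (frobN sp) (abA sp)) -mulr_natl rmorphM.
Qed.

Lemma order_Sylows : #|G|%:Z = 1 + \sum_(p <- s) #|G : N p|%:Z * (#|A p|%:Z - 1).
Proof.
have := sum_over_Sylows simG nsolG nil2 (F := fun _ => 1 : int) (fun _ _ _ => erefl).
rewrite sumr_const natz => ->; congr (_ + _).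
rewrite [LHS]big_seq [RHS]big_seq; apply: eq_bigr => p sp.
rewrite sumr_const cardsD1_pred -mulr_natl natz natz; congr (_ * _).
by rewrite -subn1 -subzn.
Qed.

Lemma normA_column p : p \in s ->
  \sum_(k : Iirr G) normA (A p) k = (#|A p|%:Z - 1) * #|A p|%:Z.
Proof.
move=> sp; apply/eqP; rewrite -(eqr_int algC) rmorph_sum /=.
rewrite (eq_bigr (fun k => \sum_(x in (A p)^#) `|'chi[G]_k x| ^+ 2)) => [|k _]; last first.
  by rewrite (normAE (TIA sp) (frobN sp) (abA sp)).
rewrite exchange_big /= (eq_bigr (fun _ => #|A p|%:R)) => [|x Ax].
  apply/eqP; rewrite sumr_const cardsD1_pred -[LHS]mulr_natl [RHS]rmorphM /=.
  congr (_ * _); exact: card_pred_intr.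
have Gx : x \in G by have /setD1P[_ /(subsetP (pHall_sub (aSylowP G p)))] := Ax.
have := second_orthogonality_relation x Gx; rewrite class_refl (centA sp Ax) mulr1n => <-.
by apply: eq_bigr => k _; rewrite normCK.
Qed.

(** Each prime at which [k] is exceptional would contribute more than half of [#|G|] to the norm. *)
Lemma exceptional_disjoint p r (k : Iirr G) : p \in s -> r \in s -> p != r ->
  exceptional (A p) k -> ~~ exceptional (A r) k.
Proof.
move=> sp sr nepr Ep; apply/negP=> Er.
have /natrP[n degn] := Cnat_irr1 k.
have := irr_norm_Sylows degn.
rewrite (bigD1_seq p) ?primes_uniq //= (big_rem r) ?mem_primes //=; last first.
  by rewrite -mem_primes.
rewrite eq_sym nepr; set Y := \sum_(_ <- _ | _) _.
have Y0 : 0 <= Y.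
  rewrite /Y big_seq_cond; apply: sumr_ge0 => t /andP[/mem_rem st _].
  by rewrite mulr_ge0 // (normA_ge0 (TIA st) (frobN st) (abA st)).
have Wp := exceptional_normA (TIA sp) (frobN sp) (abA sp) Ep.
have Wr := exceptional_normA (TIA sr) (frobN sr) (abA sr) Er.
have := l_small sp; have := l_small sr; have := orderG sp; have := orderG sr.
have : (0 < #|G : N p|)%N by apply: indexg_gt0.
have : (0 < #|G : N r|)%N by apply: indexg_gt0.
have : (0 < #|N p : A p|)%N by apply: indexg_gt0.
have : (0 < #|N r : A r|)%N by apply: indexg_gt0.
move: Y0 Wp Wr {degn}; move: Y (normA (A p) k) (normA (A r) k) #|G| #|G : N p| #|G : N r|.
move: #|A p| #|A r| #|N p : A p| #|N r : A r|; clear.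
move=> a b l l' Y W W' o g g' Y0 leW leW' l0 l0' g0 g0' eo' eo la lb eN.
have leg : g%:Z * (l%:Z * (a%:Z - l%:Z)) <= g%:Z * W by rewrite ler_pM2l.
have leg' : g'%:Z * (l'%:Z * (b%:Z - l'%:Z)) <= g'%:Z * W' by rewrite ler_pM2l.
have lt1 : o%:Z < 2 * (g%:Z * (l%:Z * (a%:Z - l%:Z))).
  have -> : 2 * (g%:Z * (l%:Z * (a%:Z - l%:Z))) = g%:Z * l%:Z * (2 * (a%:Z - l%:Z)) by ring.
  have -> : o%:Z = g%:Z * l%:Z * a%:Z by rewrite eo !PoszM; ring.
  by rewrite ltr_pM2l ?mulr_gt0 //; lia.
have lt2 : o%:Z < 2 * (g'%:Z * (l'%:Z * (b%:Z - l'%:Z))).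
  have -> : 2 * (g'%:Z * (l'%:Z * (b%:Z - l'%:Z))) = g'%:Z * l'%:Z * (2 * (b%:Z - l'%:Z)) by ring.
  have -> : o%:Z = g'%:Z * l'%:Z * b%:Z by rewrite eo' !PoszM; ring.
  by rewrite ltr_pM2l ?mulr_gt0 //; lia.
have := sqr_ge0 n%:Z; lia.
Qed.

(* Second orthogonality at [(x, y)]: the terms other than the principal one
   are integers, pairwise equal under complex conjugation. *)
Lemma exceptional_link p r x y : p \in s -> r \in s -> p != r ->
    x \in (A p)^# -> y \in (A r)^# ->
    (forall k : Iirr G, exceptional (A p) k -> 'chi_k y = 0) ->
  exists2 k : Iirr G, exceptional (A r) k & 'chi_k x != 0.
Proof.
move=> sp sr nepr Ax Ay v1; apply/exists_inP; apply: contraT.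
rewrite negb_exists_in => /forall_inP v2.
have Gx : x \in G by have /setD1P[_ /(subsetP (pHall_sub (aSylowP G p)))] := Ax.
have Gy : y \in G by have /setD1P[_ /(subsetP (pHall_sub (aSylowP G r)))] := Ay.
have nxy : x \notin (y ^: G)%g.
  apply/negP=> /imsetP[g Gg xy].
  have [[ntx Axx] [_ Ayy]] := (setD1P Ax, setD1P Ay).
  have px : p.-elt x := mem_p_elt (pHall_pgroup (aSylowP G p)) Axx.
  have ry : r.-elt y := mem_p_elt (pHall_pgroup (aSylowP G r)) Ayy.
  have rx : r.-elt x by rewrite /p_elt xy orderJ.
  have := pnat_neq_coprime px rx nepr; rewrite /coprime gcdnn order_eq1.
  by rewrite (negPf ntx).
pose F (k : Iirr G) := 'chi_k x * ('chi_k y)^*.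
have intF k : F k \in Num.int.
  rewrite /F; have [Ep | nEp] := boolP (exceptional (A p) k).
    by rewrite v1 // conjC0 mulr0 rpred0.
  have [Er | nEr] := boolP (exceptional (A r) k).
    by have := v2 k Er; rewrite negbK => /eqP->; rewrite mul0r rpred0.
  have [z ->] := nonexceptional_value (TIA sp) (frobN sp) (abA sp) nEp; last exact: Ax.
  have [t ->] := nonexceptional_value (TIA sr) (frobN sr) (abA sr) nEr; last exact: Ay.
  by rewrite conj_intr ?intr_int // rpredM ?intr_int.
have conjF k : F (conjC_Iirr k) = F k.
  by rewrite -[RHS](conj_intr (intF k)) /F conjC_IirrE !cfunE rmorphM.
have : \sum_k F k = 0 by rewrite second_orthogonality_relation // (negPf nxy).
rewrite (bigD1 0) //=; have -> : F 0 = 1 by rewrite /F irr0 !cfun1E Gx Gy conjC1 mulr1.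
rewrite (bigID (fun k : Iirr G => (k < conjC_Iirr k)%N)) /=.
have -> : \sum_(k : Iirr G | (k != 0) && ~~ (k < conjC_Iirr k)%N) F k =
          \sum_(k : Iirr G | (k != 0) && (k < conjC_Iirr k)%N) F k.
  rewrite (reindex_inj (inv_inj (@conjC_IirrK _ G))) /=.
  apply: eq_big => [k | k _]; last exact: conjF.
  rewrite conjC_Iirr_eq0 conjC_IirrK; have [//|ntk] := eqVneq k 0.
  rewrite -leqNgt leq_eqVlt; case: eqP => // /ord_inj/eqP.
  by rewrite eq_sym (negPf (odd_irr_conj_neq oddG ntk)).
set Z := \sum_(k | _) _.
have /intrP[z ->] : Z \in Num.int by apply: rpred_sum => k _; apply: intF.
move/eqP; rewrite -mulr2n -mulr_natl -[1]/(1%:~R) -[2]/(2%:~R) -rmorphM -rmorphD.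
by rewrite intr_eq0 => /eqP; clear; lia.
Qed.

Lemma aSylow_pred_gt0 p : p \in s -> 0 < #|A p|%:Z - 1.
Proof.
move=> sp; have := l_small sp; have := indexg_gt0 (N p) (A p).
by move: #|A p| #|N p : A p| => a l; lia.
Qed.

Lemma aSylow_nontrivial p : p \in s -> exists x, x \in (A p)^#.
Proof.
by move=> sp; have /trivgPn[x Ax ntx] := aSylow_neq1 sp; exists x; rewrite !inE ntx.
Qed.

Lemma aSylow_notin_class p r y :
  p != r -> y \in (A r)^# -> y \notin class_support (A p)^# G.
Proof.
move=> nepr /setD1P[nty Ay]; apply/negP=> /aSylow_elt[py _].
have ry : r.-elt y := mem_p_elt (pHall_pgroup (aSylowP G r)) Ay.
have := pnat_neq_coprime py ry nepr; rewrite /coprime gcdnn order_eq1.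
by rewrite (negPf nty).
Qed.

Lemma nonexceptional_normA_ge p (k : Iirr G) x :
    p \in s -> ~~ exceptional (A p) k -> x \in (A p)^# ->
  'chi_k x != 0 -> #|A p|%:Z - 1 <= normA (A p) k.
Proof.
move=> sp nE Ax nz; have [z vz] := nonexceptional_value (TIA sp) (frobN sp) (abA sp) nE.
rewrite (normA_value (TIA sp) (frobN sp) (abA sp) vz) ler_peMr ?(ltW (aSylow_pred_gt0 sp)) //.
have : z != 0 by move: nz; rewrite vz // intr_eq0.
by rewrite -sqrf_eq0 -gtz0_ge1 lt_def sqr_ge0 => ->.
Qed.

Lemma nonexceptional_normA_eq0 p (k : Iirr G) x :
    p \in s -> ~~ exceptional (A p) k -> x \in (A p)^# ->
  (normA (A p) k == 0) = ('chi_k x == 0).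
Proof.
move=> sp nE Ax; have [z vz] := nonexceptional_value (TIA sp) (frobN sp) (abA sp) nE.
rewrite (normA_value (TIA sp) (frobN sp) (abA sp) vz) vz // intr_eq0.
by rewrite mulf_eq0 gt_eqF ?aSylow_pred_gt0 //= sqrf_eq0.
Qed.

(** As [k0] vanishes on [A r], so do all [p]-exceptional characters. Then [exceptional_link] gives
    one [r]-exceptional character not vanishing on [A p], hence none vanishes there, and [k] takes a
    constant nonzero integer value on [(A p)^#]. *)
Lemma exceptional_cross p r (k0 k : Iirr G) : p \in s -> r \in s -> p != r ->
    exceptional (A p) k0 -> normA (A r) k0 = 0 -> exceptional (A r) k ->
  #|A p|%:Z - 1 <= normA (A p) k.
Proof.
move=> sp sr nepr Ek0 W0 Ek; have nerp : r != p by rewrite eq_sym.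
have [x Ax] := aSylow_nontrivial sp; have [y Ay] := aSylow_nontrivial sr.
have nEk0 := exceptional_disjoint sp sr nepr Ek0.
have nEk := exceptional_disjoint sr sp nerp Ek.
have v0 : 'chi_k0 y = 0.
  by apply/eqP; rewrite -(nonexceptional_normA_eq0 sr nEk0 Ay) W0.
have nAy := aSylow_notin_class nepr Ay; have nAx := aSylow_notin_class nerp Ax.
have v1 (k' : Iirr G) : exceptional (A p) k' -> 'chi_k' y = 0.
  by move=> Ek'; apply: (exceptional_vanishing (TIA sp) (frobN sp) (abA sp) nAy Ek0 Ek').
have [k2 Ek2 nz2] := exceptional_link sp sr nepr Ax Ay v1.
apply: (nonexceptional_normA_ge sp nEk Ax); apply: contraNneq nz2 => vk; apply/eqP.
exact: (exceptional_vanishing (TIA sr) (frobN sr) (abA sr) nAx Ek Ek2 vk).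
Qed.

Local Notation E p := [set k : Iirr G | exceptional (A p) k].

Section Row.

Variables (p : nat) (k0 : Iirr G).
Hypotheses (sp : p \in s) (Ek0 : exceptional (A p) k0).

Local Notation B r := (normA (A r) k0 != 0).

Lemma exceptional_row n : 'chi_k0 1%g = n%:R ->
  n%:Z ^+ 2 + #|G : N p|%:Z * (#|N p : A p|%:Z * (#|A p|%:Z - #|N p : A p|%:Z))
    + \sum_(r <- s | (r != p) && B r) #|G : N r|%:Z * (#|A r|%:Z - 1) <= #|G|%:Z.
Proof.
move=> degn; rewrite (irr_norm_Sylows degn) (bigD1_seq p) ?primes_uniq //= -addrA lerD2l.
apply: lerD.
  rewrite ler_pM2l ?ltz_nat ?indexg_gt0 //.
  exact: exceptional_normA (TIA sp) (frobN sp) (abA sp) _ Ek0.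
rewrite [leLHS]big_mkcondr big_seq_cond [leRHS]big_seq_cond.
apply: ler_sum => r /andP[sr nerp]; case: ifP => [Wn0 | /negbFE/eqP->]; last by rewrite mulr0.
rewrite ler_pM2l ?ltz_nat ?indexg_gt0 //; have [y Ay] := aSylow_nontrivial sr.
rewrite eq_sym in nerp; have nEk0 := exceptional_disjoint sp sr nerp Ek0.
apply: (nonexceptional_normA_ge sr nEk0 Ay).
by rewrite -(nonexceptional_normA_eq0 sr nEk0 Ay).
Qed.

(** In the column sum of [normA_column], the three terms on the left come from the principal
    character, the [p]-exceptional ones and those exceptional at a prime where [k0] vanishes. These
    families are disjoint. *)
Lemma exceptional_column :
  (#|A p|%:Z - 1) + #|E p|%:Z * (#|N p : A p|%:Z * (#|A p|%:Z - #|N p : A p|%:Z))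
    + (\sum_(r <- s | (r != p) && ~~ B r) #|E r|%:Z) * (#|A p|%:Z - 1)
  <= (#|A p|%:Z - 1) * #|A p|%:Z.
Proof.
set c := #|A p|%:Z - 1; set e := _ * (_ - _).
have c_gt0 : 0 < c := aSylow_pred_gt0 sp.
rewrite -(normA_column sp) -/c.
have cardE (r : nat) (x : int) :
    #|E r|%:Z * x = \sum_(k : Iirr G) (if exceptional (A r) k then x else 0).
  rewrite -big_mkcond sumr_const -mulr_natl natz; congr (Posz _ * _).
  by apply: eq_card => k; rewrite !inE.
rewrite cardE mulr_suml (eq_bigr _ (fun r _ => cardE r c)) exchange_big /=.
have def_c : \sum_(k : Iirr G) (if k == 0 then c else 0) = c.
  by rewrite -big_mkcond big_pred1_eq.
rewrite -{1}def_c -!big_split /=; apply: ler_sum => k _.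
have W0 := normA_ge0 (TIA sp) (frobN sp) (abA sp) k.
have nE0 r : r \in s -> ~~ exceptional (A r) (0 : Iirr G).
  by move=> sr; apply: irr0_nonexceptional.
have [Ekp | nEkp] := boolP (exceptional (A p) k).
  have -> : (k == 0) = false by apply: contraTF Ekp => /eqP->; apply: nE0.
  rewrite add0r big_seq_cond big1 ?addr0 => [|r /and3P[sr nerp _]].
    exact: exceptional_normA (TIA sp) (frobN sp) (abA sp) _ Ekp.
  by rewrite ifN // (exceptional_disjoint sp sr _ Ekp) // eq_sym.
rewrite addr0; have [-> | ntk] := eqVneq k 0.
  rewrite big_seq_cond big1 ?addr0 => [|r /and3P[sr _ _]]; last by rewrite ifN ?nE0.
  have [x Ax] := aSylow_nontrivial sp; apply: (nonexceptional_normA_ge sp (nE0 p sp) Ax).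
  have Gx : x \in G by have /setD1P[_ /(subsetP (pHall_sub (aSylowP G p)))] := Ax.
  by rewrite irr0 cfun1E Gx oner_eq0.
rewrite add0r; case: (boolP (has (fun r => [&& r != p, ~~ B r & exceptional (A r) k]) s)).
  case/hasP=> r sr /and3P[nerp nBr Ekr].
  rewrite big_mkcond (bigD1_seq r) ?primes_uniq //= nerp nBr Ekr.
  rewrite big_seq_cond big1 ?addr0; last first.
    move=> t /andP[st netr]; case: ifP => // _.
    by rewrite ifN // (exceptional_disjoint sr st _ Ekr) // eq_sym.
  rewrite eq_sym in nerp.
  by apply: (exceptional_cross sp sr nerp Ek0 _ Ekr); apply/eqP; rewrite -[_ == _]negbK.
move/hasPn=> none; rewrite big_seq_cond big1 // => r /and3P[sr nerp nBr].
by have := none r sr; rewrite nerp nBr /= => /negPf->.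
Qed.

End Row.

Lemma odd_order_absurd : False.
Proof.
have s0 : exists n, has (fun p => #|A p| == n) s.
  have ntG : (1 < #|G|)%N.
    rewrite cardG_gt1; apply: contraNneq nsolG => ->; exact: solvable1.
  exists #|A (pdiv #|G|)|; apply/hasP; exists (pdiv #|G|) => //.
  by rewrite mem_primes pdiv_prime // pdiv_dvd cardG_gt0.
have [n1 /hasP[p1 sp1 /eqP a1n1] min1] := ex_minnP s0.
have {}min1 p : p \in s -> (#|A p1| <= #|A p|)%N.
  by move=> sp; rewrite a1n1 min1 //; apply/hasP; exists p.
have cardE p : p \in s -> #|A p|%:Z - 1 <= #|N p : A p|%:Z * #|E p|%:Z.
  by move=> sp; apply: card_exceptional (TIA sp) (frobN sp) (abA sp) (l_small sp).
have [k0 Ek0] : exists k0 : Iirr G, exceptional (A p1) k0.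
  have : E p1 != set0.
    rewrite -card_gt0 lt0n; apply: contraTneq (cardE _ sp1) => ->.
    by rewrite mulr0 -ltNge aSylow_pred_gt0.
  by case/set0Pn=> k0; rewrite inE; exists k0.
have /natrP[d degk] := Cnat_irr1 k0.
have d_gt1 : 1 < d%:Z ^+ 2.
  have d0 : d != 0%N by rewrite -(pnatr_eq0 algC) -degk irr1_neq0.
  suff : d != 1%N by move: d0; case: (d) => [|[|n]] // _ _; nia.
  apply: contraTneq Ek0 => d1; have lin : 'chi_k0 \is a linear_char.
    by rewrite qualifE /= irr_char degk d1 eqxx.
  suff -> : k0 = 0 by apply: irr0_nonexceptional.
  apply/eqP; rewrite -subGcfker -{1}(simple_nonsol_perfect simG nsolG).
  by rewrite -lin_irr_der1.
pose B p := normA (A p) k0 != 0.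
have cls : #|G|%:Z = 1 + #|G : N p1|%:Z * (#|A p1|%:Z - 1) +
    \sum_(p <- s | (p != p1) && B p) #|G : N p|%:Z * (#|A p|%:Z - 1) +
    \sum_(p <- s | (p != p1) && ~~ B p) #|G : N p|%:Z * (#|A p|%:Z - 1).
  rewrite order_Sylows (bigD1_seq p1) ?primes_uniq //= -!addrA; do 2 congr (_ + _).
  by rewrite (bigID B).
(* Minimality of [A p1] enters here: [#|G : N p| * #|N p : A p|] is [#|G| / #|A p|], at most the
   same quotient at [p1]. *)
have leSC : \sum_(p <- s | (p != p1) && ~~ B p) #|G : N p|%:Z * (#|A p|%:Z - 1) <=
    #|G : N p1|%:Z * #|N p1 : A p1|%:Z * \sum_(p <- s | (p != p1) && ~~ B p) #|E p|%:Z.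
  rewrite mulr_sumr big_seq_cond [leRHS]big_seq_cond; apply: ler_sum => p /andP[sp _].
  apply: (@le_trans _ _ (#|G : N p|%:Z * (#|N p : A p|%:Z * #|E p|%:Z))).
    by rewrite ler_pM2l ?ltz_nat ?indexg_gt0 ?cardE.
  rewrite mulrA ler_wpM2r // -!PoszM lez_nat.
  have := orderG sp; rewrite {1}(orderG sp1) => eo.
  rewrite -(@leq_pmul2l #|A p1|) ?cardG_gt0 // [leqRHS]mulnCA eo mulnCA.
  by rewrite leq_mul2l leq_mul2r min1 // !orbT.
have /dvdnP[w ew] := Frobenius_ker_dvd_ker1 (frobN sp1).
have ea : #|A p1|%:Z = w%:Z * #|N p1 : A p1|%:Z + 1.
  by rewrite -PoszM -ew -(prednK (cardG_gt0 (A p1))) /= -addn1 PoszD.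
apply: (odd_count_absurd _ _ _ ea _ d_gt1 (exceptional_row sp1 Ek0 degk)
  (exceptional_column sp1 Ek0) (cardE _ sp1) cls leSC).
- have := l_small sp1; have := aSylow_pred_gt0 sp1.
  move: ea; move: #|A p1| #|N p1 : A p1|; clear; case: w => [|[|w]] //; lia.
- by rewrite lez_nat indexg_gt0.
- by rewrite lez_nat indexg_gt0.
- by rewrite (orderG sp1) !PoszM mulrA.
Qed.

End OddOrder.

End Characters.

(** * Groups of order 60 and their perfect central extensions *)

Lemma coset_perm_embedding (gT : finGroupType) (G H : {group gT}) n :
    #|G : H| = n -> gcore H G = 1 ->
  exists f : {morphism G >-> {perm 'I_n}}, 'injm f.
Proof.
move=> <- coreH; pose S := rcosets H G.
have actS : [acts G, on S | 'Rs] := actsRs_rcosets H G.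
have condS : actby_cond G S 'Rs by [].
pose to := <[condS]>%act.
have S_H : (H : {set gT}) \in S by apply/rcosetsP; exists 1; rewrite ?group1 ?mulg1 ?rcoset1.
pose f g (i : 'I_#|S|) := enum_rank_in S_H (to (enum_val i) g).
have S_to x g : x \in S -> to x g \in S.
  move=> Sx; rewrite /= /actby; case: ifP => // /andP[_ Gg].
  by rewrite -[_ \in _](actsP actS g Gg) in Sx.
have f_inj g : injective (f g).
  move=> i j; have [Si Sj] := (enum_valP i, enum_valP j).
  move/(congr1 enum_val); rewrite !enum_rankK_in ?S_to //.
  by move/act_inj/enum_val_inj.
have fM : {in G &, {morph (fun g => perm (@f_inj g)) : g h / g * h}}.
  move=> g h Gg Gh; apply/permP=> i; rewrite permM !permE /f.
  have Si := enum_valP i; rewrite enum_rankK_in ?S_to //.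
  by rewrite actMin.
exists (Morphism fM); apply/subsetP=> g /morphpreP[Gg /set1P fg1].
suff : g \in gcore H G by rewrite coreH.
rewrite -astabRs_rcosets; apply/astabP=> x Sx.
have : enum_val (perm (@f_inj g) (enum_rank_in S_H x)) = x.
  by move: fg1 => /= ->; rewrite perm1 enum_rankK_in.
rewrite permE /f !enum_rankK_in ?S_to //= /actby Sx Gg /=.
by move=> ->.
Qed.

Lemma der1_sub_Alt (T : finType) (H : {group {perm T}}) : H^`(1) \subset 'Alt_T.
Proof.
rewrite gen_subG; apply/subsetP=> _ /imset2P[x y _ _ ->].
by rewrite Alt_even !odd_permM !odd_permV; do 2 case: odd_perm.
Qed.

Lemma perfect_central_Sylow (gT : finGroupType) (G P Z : {group gT}) p :
    p.-Sylow(G) P -> G^`(1) = G -> Z \subset 'Z(G) -> Z :&: P \subset P^`(1).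
Proof.
move=> sylP perfG cZ; apply/subsetP=> z /setIP[/(subsetP cZ)/centerP[Gz cGz] Pz].
apply: transfer_perfect sylP perfG Pz _ => n x Gx _.
suff -> : [~ z ^+ n, x] = 1 by [].
by apply/eqP/commgP; apply/commute_sym/commuteX/commute_sym/cGz.
Qed.

Lemma perfect_normal_cyclic_central (gT : finGroupType) (G N : {group gT}) :
  G^`(1) = G -> N <| G -> cyclic N -> N \subset 'Z(G).
Proof.
move=> perfG /andP[sNG nNG] cN; rewrite subsetI sNG centsC -ker_conj_aut.
rewrite -[_ \subset _]/(G \subset conj_aut N @*^-1 1) -sub_morphim_pre //.
have abA : abelian (conj_aut N @* G).
  exact: abelianS (Aut_conj_aut N G) (Aut_cyclic_abelian cN).
by rewrite -{1}perfG morphim_der // (derG1P abA) subxx.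
Qed.

Lemma Sylow_normal_of_card (gT : finGroupType) (G P : {group gT}) p :
    prime p -> p.-Sylow(G) P ->
  all (fun n => (n %% p == 1%N) ==> (n == 1%N)) (divisors #|G|) -> P <| G.
Proof.
move=> p_pr sylP /allP/(_ #|'Syl_p(G)|); rewrite /(_ <| _) (pHall_sub sylP) /=.
rewrite -dvdn_divisors // card_Syl_dvd card_Syl_mod // eqxx => /(_ isT).
by rewrite (card_Syl sylP) indexg_eq1 subsetI => /andP[].
Qed.

Lemma perfect_sol_trivg (gT : finGroupType) (G : {group gT}) :
  G^`(1) = G -> solvable G -> G :=: 1.
Proof.
move=> perfG solG; apply/eqP; apply: contraT => ntG.
by have := sol_der1_proper solG (subxx _) ntG; rewrite perfG properxx.
Qed.

(** Burnside's transfer theorem for a perfect group: fusion in [P] is realised by its normaliser,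
    hence is trivial. *)
Lemma Sylow_cent_norm_perfect (gT : finGroupType) (G P : {group gT}) p :
    p.-Sylow(G) P -> G^`(1) = G -> 'N_G(P) \subset 'C(P) -> P :=: 1.
Proof.
move=> sylP perfG cP; have sPG := pHall_sub sylP.
have abP : abelian P.
  by apply: subset_trans cP; rewrite subsetI sPG normG.
apply/trivgP/subsetP=> g Pg; rewrite -(derG1P abP).
apply: (transfer_perfect sylP perfG Pg) => n x Gx Px.
have [m /(subsetP cP)/centP cPm e] := abelian_Sylow_fusion sylP abP (groupX n Pg) Gx Px.
rewrite commgEl e conjgE -(cPm _ (groupX n Pg)) mulKg mulVg; exact: group1.
Qed.

Lemma Sylow_order60_abelian (gT : finGroupType) (G P : {group gT}) p :
  #|G| = 60 -> p.-Sylow(G) P -> abelian P.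
Proof.
move=> oG sylP; apply: p2group_abelian (pHall_pgroup sylP) _.
rewrite (card_Hall sylP) oG logn_part.
have [|] := boolP (p \in primes 60); last by rewrite -logn_gt0 -eqn0Ngt => /eqP->.
by rewrite (_ : primes 60 = [:: 2; 3; 5]) // !inE => /or3P[]/eqP->.
Qed.

Lemma perfect_order60_Alt5 (gT : finGroupType) (G : {group gT}) :
  G^`(1) = G -> #|G| = 60 -> G \isog 'Alt_('I_5).
Proof.
move=> perfG oG; have nsolG : ~~ solvable G.
  by apply/negP=> /(perfect_sol_trivg perfG) G1; rewrite G1 cards1 in oG.
have [P sylP] := Sylow_exists 2 G; have [sPG pP _] := and3P sylP.
have oP : #|P| = 4 by rewrite (card_Hall sylP) oG p_part.
have abP := Sylow_order60_abelian oG sylP.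
have centP : 'N_G(P) \subset 'C(P) -> False.
  by move/(Sylow_cent_norm_perfect sylP perfG) => P1; rewrite P1 cards1 in oP.
pose N := 'N_G(P)%G; have sPN : P \subset N by rewrite subsetI sPG normG.
have nPN : P <| N by rewrite /(_ <| _) sPN subsetIr.
have iN : #|G : N| = 5.
  have := Lagrange (subsetIl G 'N(P)); rewrite oG -/(gval N) => eG.
  have /dvdnP[k oN] : 4 %| #|N| by rewrite -oP cardSg.
  (* Here [#|N| = k * 4]. For [k = 1] or [k = 5] the normaliser would centralise [P], and for
     [k = 15] the group would be soluble. *)
  have [k1 | [k3 | [k5 | k15]]] : k = 1%N \/ k = 3 \/ k = 5 \/ k = 15.
  - have : k %| 15 
      by apply/dvdnP; exists #|G : N|; move: eG; rewrite -/N oN; lia.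
    by rewrite -[k %| 15]/(k %| 15) dvdn_divisors // !inE; case/or4P=> /eqP; auto.
  - case: centP; suff /eqP <- : P :==: N by [].
    by rewrite eqEcard sPN oP oN k1.
  - by move: eG; rewrite -/N oN k3; move: #|G : N| => j; lia.
  - case: centP.
    have [Q sylQ] := Sylow_exists 5 N; have [sQN pQ _] := and3P sylQ.
    have oQ : #|Q| = 5 by rewrite (card_Hall sylQ) oN k5 p_part.
    have nQN : Q <| N.
      by apply: Sylow_normal_of_card sylQ _; rewrite // oN k5.
    have cPQ : Q \subset 'C(P).
      rewrite centsC; apply/commG1P/trivgP.
      rewrite -(@coprime_TIg _ P Q) ?oP ?oQ // commg_subI // subsetI subxx.
        by rewrite (subset_trans sPN) ?normal_norm.
      by rewrite (subset_trans sQN) ?normal_norm.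
    suff <- : P * Q = N by rewrite mul_subG.
    apply/eqP; rewrite eqEcard mul_subG //= TI_cardMg ?oP ?oQ ?oN ?k5 //.
    by rewrite coprime_TIg ?oP ?oQ.
  - case/negP: nsolG.
    have eNG : N :=: G by apply/eqP; rewrite eqEcard subsetIl oG oN k15.
    rewrite eNG in nPN; rewrite (series_sol nPN) (pgroup_sol pP).
    have oQG : #|G / P| = 15.
      by rewrite card_quotient ?normal_norm // -divgS // oG oP.
    have [Q sylQ] := Sylow_exists 5 (G / P); have [sQN pQ _] := and3P sylQ.
    have oQ : #|Q| = 5 by rewrite (card_Hall sylQ) oQG p_part.
    have nQ : Q <| G / P.
      by apply: Sylow_normal_of_card sylQ _; rewrite // oQG.
    rewrite (series_sol nQ) (pgroup_sol pQ) /=; apply: abelian_sol; apply: cyclic_abelian.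
    by rewrite prime_cyclic // card_quotient ?normal_norm // -divgS // oQG oQ.
have [f injf] : exists f : {morphism G >-> {perm 'I_5}}, 'injm f.
  (* A minimal normal subgroup [M] inside the core lies in the soluble group [N] of order 12, so
     [#|M|] is 2, 3 or 4. A cyclic [M] would be central, hence trivial by transfer; order 4 would
     make a Sylow 2-subgroup normal. *)
  apply: (coset_perm_embedding iN); apply/eqP; apply: contraT => ntK.
  have nKG : G \subset 'N(gcore N G) := gcore_norm _ _.
  have [M minM sMK] := minnormal_exists ntK nKG.
  have sMN := subset_trans sMK (gcore_sub N G).
  have oN : #|N| = 12.
    by rewrite -[#|N|](@mulnK _ 5) // -{1}iN Lagrange ?oG // subsetIl.
  have solN : solvable N.
    rewrite (series_sol nPN) (pgroup_sol pP) /=; apply: abelian_sol; apply: cyclic_abelian.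
    by rewrite prime_cyclic // card_quotient ?normal_norm // -divgS // oN oP.
  have [nMG ntM /is_abelemP[p p_pr abelM]] := minnormal_solvable minM sMN solN.
  have pM := abelem_pgroup abelM.
  have sMG : M \subset G := subset_trans sMN (subsetIl _ _).
  have nsMG : M <| G by apply/andP.
  have dvM : #|M| %| 12 by rewrite -oN cardSg.
  have [_ _ [k oM]] := pgroup_pdiv pM ntM.
  have cycM : cyclic M -> False.
    move=> cM; have cMG := perfect_normal_cyclic_central perfG nsMG cM.
    have [Q sylQ sMQ] := Sylow_superset sMG pM.
    case/eqP: ntM; apply/trivgP; rewrite -(setIidPl sMQ).
    have abQ := Sylow_order60_abelian oG sylQ.
    by rewrite -(derG1P abQ) (perfect_central_Sylow sylQ).
  have [p2|p3] : p = 2 \/ p = 3.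
  - have : p \in primes 12.
      by rewrite mem_primes p_pr (dvdn_trans _ dvM) // oM dvdn_exp.
    by rewrite (_ : primes 12 = [:: 2; 3]) // !inE => /orP[]/eqP->; auto.
  - rewrite p2 in pM oM; have [M2 | M4] : #|M| = 2 \/ #|M| = 4.
    + rewrite oM; rewrite oM in dvM; case: k dvM {oM} => [|[|k]] //; [by left | by right |].
      by move/(dvdn_trans (dvdn_exp2l 2 (isT : 3 <= k.+3))).
    + by case: cycM; rewrite prime_cyclic ?M2.
    have sylM : 2.-Sylow(G) M by rewrite pHallE sMG M4 oG p_part.
    have [x Gx eM] := Sylow_trans sylM sylP.
    suff : #|G : N| == 1%N by rewrite iN.
    by rewrite indexg_eq1 subsetI subxx eM (normP (subsetP nMG x Gx)).
  - case: cycM; rewrite prime_cyclic //.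
    rewrite p3 in oM; rewrite oM; rewrite oM in dvM; case: k dvM {oM} => [|k] //.
    by move/(dvdn_trans (dvdn_exp2l 3 (isT : 2 <= k.+2))).
have isoG := sub_isog (subxx G) injf; apply: (isog_trans isoG).
have perfI : (f @* G)^`(1) = f @* G by rewrite -morphim_der ?perfG.
suff -> : (f @* G)%G = ('Alt_('I_5))%G by apply: isog_refl.
apply/val_inj/eqP; rewrite /= eqEcard -{1}perfI der1_sub_Alt /=.
by rewrite -(card_isog isoG) oG -(leq_pmul2l (isT : 0 < 2)) card_Alt card_ord.
Qed.

(** [P] is generated by [Z] and two elements [x], [y], so its derived subgroup is generated by the
    central commutator [[~ x, y]], whose square is [[~ x ^+ 2, y] = 1] as [x ^+ 2] lies in [Z]. *)
Lemma card_der1_index4 (gT : finGroupType) (P Z : {group gT}) :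
  2.-group P -> Z \subset 'Z(P) -> #|P : Z| = 4 -> #|P^`(1)| <= 2.
Proof.
move=> pP cZ iPZ; have [sZP cPZ] := subsetIP cZ.
have nsZP : Z <| P := sub_center_normal cZ; have nZP := normal_norm nsZP.
have abPZ : abelian (P / Z).
  by apply: p2group_abelian (quotient_pgroup _ pP) _; rewrite card_quotient // iPZ.
have sP'Z : P^`(1) \subset Z := der1_min nZP abPZ.
have [eZP | [M maxM sZM]] := maximal_exists sZP.
  by rewrite -eZP indexgg in iPZ.
have nsMP := p_maximal_normal pP maxM; have sMP := normal_sub nsMP.
have iMZ : #|M : Z| = 2.
  apply/eqP; rewrite -(@eqn_pmul2l #|P : M|) ?indexg_gt0 // Lagrange_index //.
  by rewrite iPZ (p_maximal_index pP maxM).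
have maxZ : maximal Z M by apply: p_index_maximal; rewrite ?iMZ.
have nsZM := normalS sZM sMP nsZP.
have [x Mx nZx] := subsetPn (proper_subn (maxgroupp maxZ)).
have [y Py nMy] := subsetPn (proper_subn (maxgroupp maxM)).
have defM : Z * <[x]> = M by apply: mulg_normal_maximal; rewrite ?cycle_subG.
have defP : M * <[y]> = P by apply: mulg_normal_maximal; rewrite ?cycle_subG.
have Px := subsetP sMP x Mx; pose XY := (<[x]> <*> <[y]>)%G.
have sXY : XY \subset P by rewrite join_subG !cycle_subG Px.
have cXYZ : XY \subset 'C(Z) by apply: subset_trans sXY _; rewrite centsC.
have defZXY : Z \* XY = P.
  rewrite cprodE //; apply/eqP; rewrite eqEsubset mul_subG // -{1}defP -defM -mulgA.
  by rewrite mulgS // mulG_subG joing_subl joing_subr.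
have cxy : [~ x, y] \in 'C(P) by apply/(subsetP cPZ)/(subsetP sP'Z)/mem_commg.
have x2Z : x ^+ 2 \in Z.
  have nZx2 := subsetP nZP x Px; apply: coset_idr; first exact: groupX.
  rewrite morphX // -iMZ -card_quotient ?normal_norm // expg_cardG //.
  exact: mem_quotient.
have defP' : P^`(1) = <[[~ x, y]]>.
  rewrite -(der_cprod 1 defZXY) (derG1P (subset_trans cPZ (centS sZP))) cprod1g.
  by apply: der1_joing_cycles; apply: (subsetP (centS sXY)).
rewrite defP' dvdn_leq // order_dvdn -commXg.
  by apply/commgP/(centsP cPZ).
by apply/commute_sym/(centP cxy).
Qed.

Lemma card_perfect_cover60 (gT : finGroupType) (G Z : {group gT}) :
  G^`(1) = G -> Z \subset 'Z(G) -> #|G : Z| = 60 -> #|Z| <= 2.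
Proof.
move=> perfG cZ iGZ; have [sZG cGZ] := subsetIP cZ.
have nsZG : Z <| G := sub_center_normal cZ; have nZG := normal_norm nsZG.
have ZP p (P : {group gT}) : p.-Sylow(G) P ->
    [/\ p.-Sylow(Z) (Z :&: P), Z :&: P \subset 'Z(P), Z :&: P \subset P^`(1)
      & #|P : Z :&: P| = (60`_p)%N].
  move=> sylP; have sPG := pHall_sub sylP.
  have sylZ := Sylow_setI_normal nsZG sylP.
  split=> //; last 1 first.
  - rewrite -divgS ?subsetIr // (card_Hall sylP) (card_Hall sylZ) -iGZ.
    by rewrite -(Lagrange sZG) partnM ?cardG_gt0 ?indexg_gt0 // mulKn ?part_gt0.
  - rewrite subsetI subsetIr; apply: subset_trans (subsetIl _ _) _.
    by rewrite (subset_trans cGZ) // centS.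
  - exact: perfect_central_Sylow sylP perfG cZ.
have Z2 : 2.-nat #|Z|.
  apply/pnatP=> // p p_pr pZ; apply: contraT => p2.
  have [P sylP] := Sylow_exists p G; have [sylZ cZP sZP' iP] := ZP p P sylP.
  (* For odd [p] the part of 60 is 1 or a prime, so [P] is cyclic over a central subgroup. *)
  have abP : abelian P.
    apply: (cyclic_factor_abelian cZP).
    apply: (dvdn_prime_cyclic p_pr).
    rewrite card_quotient ?iP; last exact/normal_norm/(sub_center_normal cZP).
    have [|p'60] := boolP (p \in primes 60).
      rewrite (_ : primes 60 = [:: 2; 3; 5]) // !inE => /or3P[]/eqP e //.
      - by rewrite e in p2.
      - by rewrite e p_part.
      - by rewrite e p_part.
    by rewrite p_part; move: p'60; rewrite -logn_gt0 -eqn0Ngt => /eqP->.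
  have Z1 : Z :&: P = 1 by apply/trivgP; rewrite -(derG1P abP).
  have lZ : 0 < logn p #|Z| by rewrite logn_gt0 mem_primes p_pr cardG_gt0.
   have /esym/eqP := card_Hall sylZ.
  by rewrite /= Z1 cards1 p_part -(expn0 p) eqn_exp2l ?prime_gt1 // -leqn0 leqNgt lZ.
have [P sylP] := Sylow_exists 2 G; have [sylZ cZP sZP' iP] := ZP 2 P sylP.
rewrite -(part_pnat_id Z2) -(card_Hall sylZ).
apply: leq_trans (subset_leq_card sZP') _.
by apply: card_der1_index4 (pHall_pgroup sylP) cZP _; rewrite iP p_part.
Qed.

Lemma perfect_cover60_isog (gT rT : finGroupType) (G Z : {group gT}) (S Y : {group rT}) :
    G^`(1) = G -> Z \subset 'Z(G) -> #|G : Z| = 60 -> #|Z| = 2 ->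
    S^`(1) = S -> Y \subset 'Z(S) -> #|S : Y| = 60 -> #|Y| = 2 ->
  G \isog S.
Proof.
move=> perfG cZ iZ oZ perfS cY iY oY.
have [[sZG cGZ] [sYS cSY]] := (subsetIP cZ, subsetIP cY).
have nZG := normal_norm (sub_center_normal cZ).
have nYS := normal_norm (sub_center_normal cY).
have isoQ : G / Z \isog S / Y.
  apply: (@isog_trans _ _ _ _ 'Alt_('I_5)).
    by apply: perfect_order60_Alt5; rewrite -?quotient_der ?perfG ?card_quotient.
  rewrite isog_sym.
  by apply: perfect_order60_Alt5; rewrite -?quotient_der ?perfS ?card_quotient.
have [f injf imf] := isogP isoQ.
pose H := [set u in setX G S | f (coset Z u.1) == coset Y u.2].
have gH : group_set H.
  apply/group_setP; split=> [|[g s] [h t]]; first by rewrite !inE !group1 /= !morph1.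
  rewrite !inE /= => /andP[/andP[Gg Ss] /eqP eg] /andP[/andP[Gh St] /eqP eh].
  rewrite !groupM //= !morphM ?eg ?eh ?mem_quotient //;
    by [apply: (subsetP nZG) | apply: (subsetP nYS)].
pose full (K : {group gT * rT}) := (fst @* K == G) && (snd @* K == S).
have fullH : full (Group gH).
  rewrite /full !eqEsubset; apply/andP; split; apply/andP; split.
  - by apply/subsetP=> _ /morphimP[[g s] _ + ->]; rewrite !inE => /andP[/andP[]].
  - apply/subsetP=> g Gg.
    have : f (coset Z g) \in S / Y by rewrite -imf mem_morphim ?mem_quotient.
    case/morphimP=> s _ Ss es; apply/morphimP; exists (g, s); rewrite ?inE //=.
    by rewrite Gg Ss es eqxx.
  - by apply/subsetP=> _ /morphimP[[g s] _ + ->]; rewrite !inE => /andP[/andP[]].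
  - apply/subsetP=> s Ss; have := mem_quotient Y Ss; rewrite -imf.
    case/morphimP=> _ _ /morphimP[g _ Gg ->] es.
    by apply/morphimP; exists (g, s); rewrite ?inE //= Gg Ss es eqxx.
have [K /mingroupP[/andP[/eqP K1 /eqP K2] minK] sKH] := mingroup_exists fullH.
(* The derived subgroup of [K] still projects onto the perfect groups [G] and [S]. *)
have perfK : K^`(1) = K.
  apply: minK (der_sub 1 K).
  by rewrite /full !morphim_der ?subsetT // K1 K2 perfG perfS !eqxx.
pose f1 := restrm_morphism (subsetT K) [morphism of @fst gT rT].
pose f2 := restrm_morphism (subsetT K) [morphism of @snd gT rT].
have im1 : f1 @* K = G by rewrite im_restrm.
have im2 : f2 @* K = S by rewrite im_restrm.
pose C := (f1 @*^-1 Z)%G.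
have iC : #|K : C| = 60.
  rewrite -iZ -(@index_morphpre _ _ _ f1 G Z) ?im1 //.
  suff <- : K :=: f1 @*^-1 G by [].
  by rewrite -im1 morphimGK ?subsetIl.
(* An element of [K] with first component in [Z] has its second in [Y], since the components agree
   modulo the kernels. *)
have cC : C \subset 'Z(K).
  apply/subsetP=> -[z y] /morphpreP[Kzy Zz]; apply/centerP; split=> // -[g s] Kgs.
  have := subsetP sKH _ Kzy; have := subsetP sKH _ Kgs; rewrite !inE /=.
  case/andP=> /andP[Gg Ss] _ /andP[/andP[Gz Sy]].
  rewrite (coset_id Zz) morph1 eq_sym => /eqP/coset_idr Yy.
  congr pair; [apply: (centsP cGZ) | apply: (centsP cSY)] => //.
  by apply: Yy; apply: (subsetP nYS).
have oK : #|K| <= 120.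
  rewrite -(Lagrange (subset_trans cC (center_sub K))) iC.
  by rewrite (@leq_mul _ _ 2 60) // (card_perfect_cover60 perfK cC).
have inj1 : 'injm f1.
  rewrite -card_im_injm im1 eqn_leq -{1}im1 leq_morphim.
  by rewrite -(Lagrange sZG) oZ iZ.
have inj2 : 'injm f2.
  rewrite -card_im_injm im2 eqn_leq -{1}im2 leq_morphim.
  by rewrite -(Lagrange sYS) oY iY.
apply: (@isog_trans _ _ _ _ K); last by rewrite -im2 sub_isog.
by rewrite isog_sym -im1 sub_isog.
Qed.

(** * Perfection, order and centre of SL(2, F) *)

Section SL2.

Import GRing.Theory.
Local Open Scope ring_scope.

Definition mat22 (R : nzRingType) (a b c d : R) : 'M[R]_2 :=
  \matrix_(i, j) if i == 0 then if j == 0 then a else b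
                 else if j == 0 then c else d.

Lemma mat22E (R : nzRingType) (M : 'M[R]_2) :
  M = mat22 (M 0 0) (M 0 1) (M 1 0) (M 1 1).
Proof.
apply/matrixP=> i j; rewrite mxE.
by case: i j => [[|[|i]] ?] [[|[|j]] ?] //=; congr (M _ _); apply: val_inj.
Qed.

Lemma mul_mat22 (R : nzRingType) (a b c d a' b' c' d' : R) :
  mat22 a b c d *m mat22 a' b' c' d' =
  mat22 (a * a' + b * c') (a * b' + b * d') (c * a' + d * c') (c * b' + d * d').
Proof.
apply/matrixP=> i j; rewrite !mxE !big_ord_recl big_ord0 !mxE /= addr0.
by do 2 case: (_ == 0).
Qed.

Lemma det_mat22 (R : comNzRingType) (a b c d : R) : \det (mat22 a b c d) = a * d - b * c.
Proof.
rewrite (expand_det_row _ 0) !big_ord_recl big_ord0 /cofactor !det_mx11 !mxE /= addr0.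
by rewrite expr0 expr1 mul1r mulN1r mulrN.
Qed.

Variable F : finFieldType.
Local Notation GL := {'GL_2[F]}.
Local Notation SL := (SLgroup_group 2 F).

(** The value is the identity when the determinant vanishes, so each use has to go through
    [gl22K]. *)
Definition gl22 (a b c d : F) : GL := insubd (1%g : GL) (mat22 a b c d).

Lemma gl22K a b c d : a * d - b * c != 0 -> GLval (gl22 a b c d) = mat22 a b c d.
Proof.
move=> nz; rewrite insubdK // unfold_in /= -/(_ \in unitmx) unitmxE det_mat22.
by rewrite unitfE.
Qed.

Lemma gl22E (u : GL) : exists a b c d, u = gl22 a b c d /\ \det (GLval u) = a * d - b * c.
Proof.
pose M := GLval u; exists (M 0 0), (M 0 1), (M 1 0), (M 1 1).
rewrite -det_mat22 -mat22E; split=> //; apply/val_inj; rewrite -[RHS]/(GLval _) gl22K.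
  exact: mat22E.
by have := GL_det u; rewrite {1}(mat22E (GLval u)) det_mat22.
Qed.

Lemma card_SL2 : (#|F|.-1 * #|SL|)%N = #|'GL_2[F]|.
Proof.
have detd (a : F) : a != 0 -> \det (GLval (gl22 a 0 0 1)) = a.
  by move=> nz; rewrite gl22K ?det_mat22 mulr1 mul0r subr0.
have fib (a : F) : a != 0 -> #|[set u : GL | \det (GLval u) == a]| = #|SL|.
  move=> nz; rewrite -(card_lcoset SL (gl22 a 0 0 1)); apply: eq_card => u.
  rewrite mem_lcoset !inE GL_ME GL_VxE det_mulmx det_inv detd //.
  by rewrite -[RHS](inj_eq (mulfI nz)) mulrA divff // mul1r mulr1.
rewrite -[RHS]sum1_card (partition_big (fun u : GL => \det (GLval u)) (fun a : F => a != 0)) /=.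
  rewrite [RHS](eq_bigr (fun=> #|SL|)) => [|a nz].
    rewrite sum_nat_const; congr (_ * _)%N.
    by rewrite (@eq_card _ _ (predC1 (0 : F))) // cardC1.
  by rewrite -(fib a nz) -sum1_card; apply: eq_bigl => u; rewrite !inE.
by move=> u _; have := GL_det u.
Qed.

(** Commutators with the diagonal matrix of [r] and [r^-1] yield all transvections, as [r ^+ 2 - 1]
    is invertible, and transvections generate. *)
Lemma SL2_perfect (r : F) : r != 0 -> r ^+ 2 != 1 -> SL^`(1)%g = SL.
Proof.
move=> nzr r2; pose T : {group GL} := (SL^`(1))%G.
have SLP a b c d : a * d - b * c = 1 -> gl22 a b c d \in SL.
  by move=> e; rewrite inE gl22K ?det_mat22 e ?oner_eq0.
have eqgl (u v : GL) : GLval u = GLval v -> u = v by apply: val_inj.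
have comm (x y D : GL) : D \in SL -> x \in SL -> (D * x = x * D * y)%g -> y \in T.
  move=> SD Sx e; have -> : y = [~ D, x].
    by apply: (mulgI (x * D)%g); rewrite -e; exact: commgC.
  exact: (mem_commg SD Sx).
have SD : gl22 r 0 0 r^-1 \in SL by apply: SLP; rewrite divff // mulr0 subr0.
have r2' : r ^+ 2 - 1 != 0 by rewrite subr_eq0.
have upper t : gl22 1 t 0 1 \in T.
  apply: (comm (gl22 1 (t * r ^+ 2 / (r ^+ 2 - 1)) 0 1) _ _ SD).
    by apply: SLP; rewrite mulr1 mulr0 subr0.
  apply: eqgl; rewrite !GL_MxE !gl22K ?mul_mat22 ?divff ?mulr1 ?mulr0 ?subr0 ?oner_eq0 //.
  by congr mat22; field; rewrite ?nzr ?r2'.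
have lower t : gl22 1 0 t 1 \in T.
  apply: (comm (gl22 1 0 (- t / (r ^+ 2 - 1)) 1) _ _ SD).
    by apply: SLP; rewrite mulr1 mul0r subr0.
  apply: eqgl; rewrite !GL_MxE !gl22K ?mul_mat22 ?divff ?mulr1 ?mul0r ?mulr0 ?subr0 ?oner_eq0 //.
  by congr mat22; field; rewrite ?nzr ?r2'.
apply/eqP; rewrite eqEsubset der_sub /=; apply/subsetP=> u.
have [a [b [c [d [-> e]]]]] := gl22E u; rewrite inE e => /eqP {}e.
rewrite -[_ \in _]/(gl22 a b c d \in T).
have step a' b' c' d' : c' != 0 -> a' * d' - b' * c' = 1 -> gl22 a' b' c' d' \in T.
  move=> nz e'; pose x := (a' - 1) / c'; pose y := (d' - 1) / c'.
  suff -> : gl22 a' b' c' d' = ((gl22 1 x 0 1)%R * (gl22 1 0 c' 1)%R * (gl22 1 y 0 1)%R)%g.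
    by rewrite !groupM.
  apply: eqgl; rewrite !GL_MxE !gl22K ?mul_mat22 ?e' ?mulr0 ?mul0r ?mulr1 ?subr0 ?oner_eq0 //.
  have b'E : b' = (a' * d' - 1) / c' by rewrite -e'; field.
  by rewrite /x /y b'E; congr mat22; field.
have [c0 | nzc] := eqVneq c 0; last exact: step nzc e.
have nzd : d != 0.
  by apply: contra_eq_neq e => ->; rewrite c0 !mulr0 subr0 eq_sym oner_eq0.
(* When [c = 0], splitting off a lower transvection makes the lower left entry [d], which is
   nonzero. *)
have -> : gl22 a b c d = ((gl22 (a + b) b d d)%R * (gl22 1 0 (- 1) 1)%R)%g.
  apply: eqgl; rewrite GL_MxE !gl22K ?e ?oner_eq0 //.
  - by rewrite mul_mat22 c0; congr mat22; ring.
  - by rewrite mulr1 mul0r subr0 oner_eq0.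
  - have -> : (a + b) * d - b * d = a * d - b * c by rewrite c0; ring.
    by rewrite e oner_eq0.
apply: (groupM _ (lower _)); apply: step => //; rewrite -e c0; ring.
Qed.

Lemma SL2_central_involution : -1 != 1 :> F -> exists2 z, z \in 'Z(SL)%g & #[z]%g = 2%N.
Proof.
move=> n1; have zE : GLval (gl22 (-1) 0 0 (-1)) = - 1%:M.
  rewrite gl22K ?mulrNN ?mulr1 ?mulr0 ?subr0 ?oner_eq0 //.
  by apply/matrixP; case=> [[|[|i]] ?] [[|[|j]] ?] //; rewrite !mxE //= oppr0.
exists (gl22 (-1) 0 0 (-1)).
  apply/centerP; split=> [|u _].
    by rewrite inE zE -scaleN1r detZ det1 mulr1 sqrrN expr1n.
  by apply: val_inj; rewrite [LHS]GL_MxE [RHS]GL_MxE zE mulNmx mulmxN mul1mx mulmx1.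
apply: nt_prime_order => //.
  by apply: val_inj; rewrite [LHS]GL_MxE zE mulNmx mulmxN mul1mx opprK.
apply: contra_neq n1 => /(congr1 (fun u : GL => GLval u 0 0)).
by rewrite zE !mxE.
Qed.

End SL2.

Lemma SL25_cover60 : exists Y : {group {'GL_2['F_5]}},
  [/\ Y \subset 'Z(SLgroup 2 'F_5), #|SLgroup 2 'F_5 : Y| = 60 & #|Y| = 2].
Proof.
have [z Zz oz] := @SL2_central_involution 'F_5 isT; exists <[z]>%G.
have sYZ : <[z]> \subset 'Z(SLgroup 2 'F_5) by rewrite cycle_subG.
split=> //; rewrite -divgS ?(subset_trans sYZ) ?center_sub // -[#|<[z]>|]/#[z] oz.
suff -> : #|SLgroup 2 'F_5| = 120 by [].
apply/eqP; rewrite -(@eqn_pmul2l 4) //.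
by have := card_SL2 'F_5; rewrite card_GL_2 card_Fp // => ->.
Qed.

Lemma SL25_perfect : (SLgroup 2 'F_5)^`(1) = SLgroup 2 'F_5.
Proof. exact: (@SL2_perfect 'F_5 2%R). Qed.

(** * Reduction to simple groups *)

Lemma nilpotent_second_maximals_quotient (gT : finGroupType) (G N : {group gT}) :
    (forall H K : {group gT}, H \proper G -> K \proper H -> nilpotent K) -> N <| G ->
  forall H K : {group coset_of N}, H \proper G / N -> K \proper H -> nilpotent K.
Proof.
move=> nil2 nsNG H K ltHG ltKH; have sHG := proper_sub ltHG.
have [H0 defH sNH0 sH0G] := inv_quotientS nsNG sHG.
have nsNH0 := normalS sNH0 sH0G nsNG.
have sKH0 : K \subset H0 / N by rewrite -defH proper_sub.
have [K0 defK sNK0 sK0H] := inv_quotientS nsNH0 sKH0.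
have nsNK0 := normalS sNK0 sK0H nsNH0.
rewrite defK quotient_nil // (nil2 H0) //.
  by rewrite -(quotient_proper nsNH0 nsNG) -defH.
by rewrite -(quotient_proper nsNK0 nsNH0) -defH -defK.
Qed.

Lemma simple_nil2_order60 (gT : finGroupType) (G : {group gT}) :
    simple G -> ~~ solvable G ->
    (forall H K : {group gT}, H \proper G -> K \proper H -> nilpotent K) ->
  #|G| = 60.
Proof.
move=> simG nsolG nil2; case: (boolP (2 %| #|G|)) => [|oddG].
  exact: even_order_60.
by case: (odd_order_absurd simG nsolG _ nil2); rewrite -[odd _]negbK -dvdn2.
Qed.

Section Reduction.

Variables (gT : finGroupType) (G R : {group gT}).
Hypotheses (perfG : G^`(1) = G) (nsRG : R <| G) (simGR : simple (G / R)).
Hypotheses (nsolGR : ~~ solvable (G / R)) (oGR : #|G : R| = 60).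
Hypothesis nil2 : forall H K : {group gT}, H \proper G -> K \proper H -> nilpotent K.

Let nRG : G \subset 'N(R) := normal_norm nsRG.
Let perfGR : (G / R)^`(1) = G / R.
Proof. by rewrite -quotient_der ?perfG. Qed.
Let oQ : #|G / R| = 60. Proof. by rewrite card_quotient. Qed.

(** It suffices that [Q / R] lies strictly inside a proper subgroup of [G / R]. If nontrivial, its
    normaliser will do: it is proper by simplicity, and larger than the abelian Sylow subgroup by
    Burnside's theorem. If trivial, a Sylow 5-subgroup will do. *)
Lemma kernel_join_Sylow_nilpotent q (Q : {group gT}) :
  q.-Sylow(G) Q -> nilpotent (Q <*> R).
Proof.
move=> sylQ; have [sQG qQ _] := and3P sylQ.
have nRQ := subset_trans sQG nRG.
have [sRG _] := andP nsRG; have sQRG : Q <*> R \subset G by rewrite join_subG sQG.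
have nsRQR : R <| Q <*> R by rewrite /(_ <| _) joing_subr join_subG nRQ normG.
have eQR : (Q <*> R) / R = Q / R by rewrite quotientYidr.
have sylQR : q.-Sylow(G / R) (Q / R) by apply: quotient_pHall.
have ltG (P : {group coset_of R}) : P \subset G / R -> solvable P -> P \proper G / R.
  by move=> sP solP; rewrite properEneq sP andbT; apply: contraNneq nsolGR => <-.
have [M [ltMG ltM]] : exists M : {group coset_of R}, M \proper G / R /\ Q / R \proper M.
  have [Q1 | ntQ] := eqVneq (Q / R) 1.
    have [P sylP] := Sylow_exists 5 (G / R); have [sP pP _] := and3P sylP.
    exists P; rewrite ltG ?(pgroup_sol pP) // Q1 proper1G -cardG_gt1.
    by rewrite (card_Hall sylP) oQ p_part.
  exists 'N_(G / R)(Q / R)%G; split.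
    rewrite properEneq subsetIl andbT; apply/eqP=> /setIidPl nQ.
    have [_ /(_ (Q / R)%G)] := simpleP _ simGR.
    rewrite /(_ <| _) quotientS // => /(_ nQ)[] e; first by rewrite e eqxx in ntQ.
    by case/negP: nsolGR; rewrite -e (pgroup_sol (quotient_pgroup _ qQ)).
  apply: contraNT ntQ; rewrite properEneq subsetI quotientS // normG !andbT negbK => /eqP e.
  apply/eqP.
  apply: (Sylow_cent_norm_perfect sylQR perfGR); rewrite -e.
  exact: Sylow_order60_abelian oQ sylQR.
have [M0 defM sRM sMG] := inv_quotientS nsRG (proper_sub ltMG).
have nsRM := normalS sRM sMG nsRG.
apply: (nil2 (H := M0)).
  by rewrite -(quotient_proper nsRM nsRG) -defM.
by rewrite -(quotient_proper nsRQR nsRM) -defM eQR.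
Qed.

(** For a Sylow [p]-subgroup [P] of [R], every Sylow [q]-subgroup of [G] with [q] other than [p]
    centralises [P]. So [G / 'C_G(P)] is a perfect [p]-group, hence trivial. *)
Lemma kernel_central : R \subset 'Z(G).
Proof.
have [sRG _] := andP nsRG; rewrite subsetI sRG.
have nilR : nilpotent R.
  have [Q sylQ] := Sylow_exists 2 G.
  exact: nilpotentS (joing_subr Q R) (kernel_join_Sylow_nilpotent sylQ).
rewrite -{1}(Sylow_gen R) gen_subG; apply/bigcupsP=> P /SylowP[p p_pr sylP].
have [sPR pP _] := and3P sylP.
have nsPG : P <| G.
  rewrite (nilpotent_Hall_pcore nilR sylP).
  exact: char_normal_trans (pcore_char _ _) nsRG.
pose C := 'C_G(P)%G; have nsCG : C <| G.
  by rewrite /(_ <| _) subsetIl normsI ?normG ?norms_cent ?normal_norm.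
suff : G \subset C by rewrite subsetI subxx centsC.
have pGC : p.-group (G / C).
  rewrite /pgroup card_quotient ?normal_norm //; apply/pnatP=> // q q_pr qGC.
  apply: contraT => nepq; have [Q sylQ] := Sylow_exists q G.
  have sQC : Q \subset C.
    rewrite subsetI (pHall_sub sylQ) /=.
    apply: sub_nilpotent_cent2 (kernel_join_Sylow_nilpotent sylQ) _ (joing_subl Q R) _.
      exact: subset_trans sPR (joing_subr Q R).
    by apply: pnat_neq_coprime pP (pHall_pgroup sylQ) _; rewrite eq_sym.
  have := dvdn_trans qGC (indexgS G sQC).
  have [_ _ q'GQ] := and3P sylQ.
  by move/pnat_dvd/(_ q'GQ); rewrite pnatE // !inE eqxx.
rewrite -quotient_sub1 ?normal_norm //.
by rewrite (perfect_sol_trivg _ (pgroup_sol pGC)) // -quotient_der ?perfG ?normal_norm.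
Qed.

End Reduction.

Theorem corollary3p7 (gT : finGroupType) (G : {group gT}) :
  ~ solvable G ->
  biminimal_nonnilpotent G ->
  G \isog SLgroup 2 'F_5 \/ G \isog 'Alt_('I_5).
Proof.
move=> /negP nsolG [_ _ subG].
have nil2 (H K : {group gT}) : H \proper G -> K \proper H -> nilpotent K.
  move=> /subG[nilH | [_ minH] /minH //] /proper_sub sKH; exact: nilpotentS nilH.
(* Solubility of proper subgroups, by Schmidt's theorem, makes [G] perfect and keeps the quotient by
   a maximal normal subgroup insoluble. *)
have solP (H : {group gT}) : H \proper G -> solvable H.
  by case/subG=> [/nilpotent_sol | [_ /min_nonnilpotent_sol]].
have perfG : G^`(1) = G.
  apply/eqP; apply: contraT => neG; case/negP: nsolG.
  rewrite (series_sol (der_normal 1 G)) solP ?abelian_sol ?sub_der1_abelian //.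
  by rewrite properEneq neG der_sub.
have ntG : G :!=: 1 by apply: contraNneq nsolG => ->; apply: solvable1.
have [R maxR] := ex_maxnormal_ntrivg ntG; have nsRG := maxnormal_normal maxR.
have simGR : simple (G / R) by rewrite quotient_simple.
have nsolGR : ~~ solvable (G / R).
  by apply: contra nsolG => sol; rewrite (series_sol nsRG) solP ?(maxnormal_proper maxR).
have oGR : #|G : R| = 60.
  rewrite -card_quotient ?normal_norm //.
  exact: simple_nil2_order60 (nilpotent_second_maximals_quotient nil2 nsRG).
have cR := kernel_central perfG nsRG simGR nsolGR oGR nil2.
have := card_perfect_cover60 perfG cR oGR; rewrite leq_eqVlt => /predU1P[oR | oR].
  left; have [Y [cY iY oY]] := SL25_cover60.
  exact: perfect_cover60_isog perfG cR oGR oR SL25_perfect cY iY oY.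
right; apply: perfect_order60_Alt5 => //; rewrite -(Lagrange (normal_sub nsRG)) oGR.
by move: oR; rewrite ltnS leq_eqVlt ltnS leqn0 -[_ == 0]negbK -lt0n cardG_gt0 orbF => /eqP->.
Qed.
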